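(* Let $A$ be an involutive Banach algebra and $\{\pi,\mathcal H\}$ a $*$-representation of $A$ on a Hilbert space $\mathcal H$. (a) If $(\xi_n)$, $(\eta_n)$ are sequences in $\mathcal H$ and $\sum\|\xi_n\|\|\eta_n\|<\infty$, then $\phi=\sum\xi_n*_\pi\eta_n\in\mathcal F_\pi(A^* )$, with $\sigma(A^*,A)$-convergence implying $\|\cdot\|_\pi$-convergence. Conversely, if $\phi\in\mathcal F_\pi(A^* )$, then there are sequences $(\xi_n)$ and $(\eta_n)$ in $\mathcal H$ such that $\sum\|\xi_n\|\|\eta_n\|<\infty$ and $\phi=\sum\xi_n*_\pi\eta_n$; moreover, $\|\phi\|_\pi=\inf\{\sum\|\xi_n\|\|\eta_n\|:\phi=\sum\xi_n*_\pi\eta_n\}$. (b) $(\mathcal F_\pi(A^* ),\|\cdot\|_\pi)$ is a left introverted homogeneous subspace of $A^*$ closed under $\phi\mapsto\phi^*$, where $\phi^*(a)=\overline{\phi(a^* )}$. Furthermore, $(\xi*_\pi\eta)^*=\eta*_\pi\xi$, and $\phi\mapsto\phi^*$ is isometric with respect to $\|\cdot\|_{A^*}$ and $\|\cdot\|_\pi$. (c) With respect to the involution defined by $\mu^*(\phi)=\overline{\mu(\phi^* )}$ for $\mu\in\mathcal F_\pi(A^* )^*$, $\phi\in\mathcal F_\pi(A^* )$, $(\mathcal F_\pi(A^* )^*,\square)$ is a $W^*$-algebra and $\breve\pi:\mathcal F_\pi(A^* )^*\to B(\mathcal H)$ given by $\langle\breve\pi(\mu)\xi|\eta\rangle_{\mathcal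 H}=\langle\mu,\xi*_\pi\eta\rangle$ is a weak$^*$-homeomorphic isometric $*$-isomorphism of $\mathcal F_\pi(A^* )^*$ onto $VN_\pi=\overline{\pi(A)}^{\,\mathrm{wk}^*}$, the von Neumann subalgebra of $B(\mathcal H)$ generated by $\pi$ on $A$. Moreover, $\breve\pi\circ\eta_\pi=\pi$, where $\eta_\pi$ is the canonical homomorphism of $A$ into $\mathcal F_\pi(A^* )^*$. (d) The map $VN_\pi\to\mathcal F_\pi(A^* )^*$, $T\mapsto\mu_T$, is a weak$^*$-homeomorphic isometric $*$-isomorphism, where $\langle\mu_T,\sum\xi_n*_\pi\eta_n\rangle=\sum\langle T\xi_n|\eta_n\rangle_{\mathcal H}$ whenever $\sum\xi_n*_\pi\eta_n\in\mathcal F_\pi(A^* )$ (with $\sum\|\xi_n\|\|\eta_n\|<\infty$). In particular, $VN_\pi$ can be identified with the dual of $\mathcal F_\pi(A^* )$.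
   Context: Involutive Banach algebra: Banach algebra with an isometric conjugate-linear anti-multiplicative involution. $\langle\cdot|\cdot\rangle$ is linear in the first variable. $A^*$ is a right $A$-module via $\langle\phi\cdot a,b\rangle=\langle\phi,ab\rangle$. $\otimes^\gamma$ is the Banach space projective tensor product. For $\xi,\eta\in\mathcal H$, $\xi*_\pi\eta\in A^*$ is $(\xi*_\pi\eta)(a)=\langle\pi(a)\xi|\eta\rangle_{\mathcal H}$. $VN_\pi$ means the weak$^*$-closure of $\pi(A)$ in $B(\mathcal H)$. The Fourier space $\mathcal F_\pi(A^* )$. Let $\overline{\mathcal H}$ be the conjugate Hilbert space, $\xi\mapsto\dot\xi$ the identity $\mathcal H\to\overline{\mathcal H}$. $\overline{\mathcal H}$ is a contractive right $A$-module via $\dot\xi\cdot a=(\pi(a)^*\xi)^{\cdot}$. Identify $\overline{\mathcal H}^*$ with $\mathcal H$ via $\langle\xi,\dot\eta\rangle=\langle\xi|\eta\rangle_{\mathcal H}$; then $\langle\xi,\dot\eta\cdot a\rangle=(\xi*_\pi\eta)(a)$. Let $p:\mathcal H\otimes^\gamma\overline{\mathcal H}\to A^*$ be the contraction with $p(\xi\otimes\dot\eta)=\xi*_\pi\eta$. $\mathcal F_\pi(A^* )=p(\mathcal H\otimes^\gamma\overline{\mathcal H})$ with the quotient norm $\|\phi\|_\pi=\inf\{\|\zeta\|_\gamma:p(\zeta)=\phi\}$. A left introverted homogeneous subspace of $A^*$ is a pair $(\mathcal S(A^* ),\|\cdot\|_{\mathcal S})$, $\mathcal S(A^* )$ a linear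 subspace of $A^*$ with complete norm $\|\cdot\|_{\mathcal S}$, such that (i) $\mathcal S(A^* )\hookrightarrow A^*$ is a contraction; (ii) $\mathcal S(A^* )$ is a right $A$-submodule of $A^*$ and $(\phi,a)\mapsto\phi\cdot a$ is contractive for $\|\cdot\|_{\mathcal S}$; (iii) for $\mu\in\mathcal S(A^* )^*$, $\phi\in\mathcal S(A^* )$, the functional $\mu\,\square\,\phi$, $\langle\mu\,\square\,\phi,a\rangle=\langle\mu,\phi\cdot a\rangle$, lies in $\mathcal S(A^* )$ and $(\mu,\phi)\mapsto\mu\,\square\,\phi\in\mathcal S(A^* )$ is contractive for $\|\cdot\|_{\mathcal S}$. Then $\mathcal S(A^* )^*$ is a Banach algebra under $\langle\mu\,\square\,\nu,\phi\rangle=\langle\mu,\nu\,\square\,\phi\rangle$, and the canonical homomorphism $A\to\mathcal S(A^* )^*$ (denoted $\eta_\pi$ for $\mathcal F_\pi(A^* )$) is $a\mapsto(\phi\mapsto\langle\phi,a\rangle)$. *)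

(* Defs.v *)
From HB Require Import structures.
From mathcomp Require Export all_boot all_order all_algebra.
From mathcomp Require Export all_classical all_reals all_analysis.
From mathcomp Require Export complex.

Set Implicit Arguments.
Unset Strict Implicit.
Unset Printing Implicit Defensive.

Import Order.TTheory GRing.Theory Num.Theory.
Import numFieldNormedType.Exports.

Local Open Scope classical_set_scope.
Local Open Scope ring_scope.

(* The norm of a normedZmodType R[i] takes its values in R[i]; [nrm] is the
   same norm as a real number. *)
Definition nrm (R : realType) (V : normedZmodType R[i]) (x : V) : R :=
  complex.Re `|x|.

Section ConjugateSpace.
Variables (R : realType) (H : normedModType R[i]).

Definition conjugate : Type := H.

HB.instance Definition _ := GRing.Zmodule.on conjugate.

Definition conj_scale (a : R[i]) (x : conjugate) : conjugate := a^* *: (x : H).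

Let conj_scaleA a b x : conj_scale a (conj_scale b x) = conj_scale (a * b) x.
Proof. by rewrite /conj_scale scalerA rmorphM. Qed.

Let conj_scale1 : left_id 1 conj_scale.
Proof. by move=> x; rewrite /conj_scale rmorph1 scale1r. Qed.

Let conj_scaleDr : right_distributive conj_scale +%R.
Proof. by move=> a x y; rewrite /conj_scale scalerDr. Qed.

Let conj_scaleDl x : {morph conj_scale^~ x : a b / a + b}.
Proof. by move=> a b; rewrite /conj_scale rmorphD scalerDl. Qed.

HB.instance Definition _ := GRing.Zmodule_isLmodule.Build R[i] conjugate
  conj_scaleA conj_scale1 conj_scaleDr conj_scaleDl.

Definition conj_norm (x : conjugate) : R[i] := `|x : H|.

Let conj_normD x y : conj_norm (x + y) <= conj_norm x + conj_norm y.
Proof. exact: ler_normD. Qed.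

Let conj_normZ (a : R[i]) x : conj_norm (a *: x) = `|a| * conj_norm x.
Proof. by rewrite /conj_norm normrZ norm_conjC. Qed.

Let conj_norm0 x : conj_norm x = 0 -> x = 0.
Proof. exact: normr0_eq0. Qed.

HB.instance Definition _ := Lmodule_isNormed.Build R[i] conjugate
  conj_normD conj_normZ conj_norm0.

Definition dot (x : H) : conjugate := x.

End ConjugateSpace.

Section NormedSubspaces.
Variables (R : realType) (V : lmodType R[i]) (S : set V) (N : V -> R).

(* (S, N) is a Banach space: S is a linear subspace of V, and N, of which only
   the values on S matter, is a complete norm on S. *)
Record banach_on : Prop := BanachOn {
  banach_on0 : S 0;
  banach_onP : forall (a : R[i]) x y, S x -> S y -> S (a *: x + y);
  banach_on_norm0 : forall x, S x -> N x = 0 -> x = 0;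
  banach_on_normD : forall x y, S x -> S y -> N (x + y) <= N x + N y;
  banach_on_normZ : forall (a : R[i]) x, S x ->
    N (a *: x) = nrm a * N x;
  banach_on_complete : forall u : nat -> V, (forall n, S (u n)) ->
    (forall e, 0 < e ->
      exists n0, forall m n, (n0 <= m)%N -> (n0 <= n)%N -> N (u m - u n) < e) ->
    exists2 l, S l & N (u n - l) @[n --> \oo] --> (0 : R)
}.

(* The dual of (S, N).  A functional on S is represented by the function on V
   that agrees with it on S and vanishes outside S, so that each functional has
   exactly one representative. *)
Definition dual : set (V -> R[i]^o) := [set mu |
  [/\ forall x, ~ S x -> mu x = 0,
      forall (a : R[i]) x y, S x -> S y -> mu (a *: x + y) = a * mu x + mu y &
      exists M : R, forall x, S x -> nrm (mu x) <= M * N x]].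

Definition dual_norm (mu : V -> R[i]^o) : R :=
  sup [set nrm (mu x) | x in [set x | S x /\ N x <= 1]].

(* On [dual], the topology of pointwise convergence is sigma(S^*, S). *)
Definition weakstar : topologicalType := {ptws V -> R[i]^o}.

End NormedSubspaces.

(* A *-algebra with a norm, carried by the subset [dom] of a vector space. *)
Record star_data (R : realType) := StarData {
  carrier :> lmodType R[i];
  dom : set carrier;
  norm : carrier -> R;
  mul : carrier -> carrier -> carrier;
  star : carrier -> carrier
}.
Arguments dom {R} _.
Arguments norm {R} _.
Arguments mul {R} _.
Arguments star {R} _.

Section StarAlgebras.
Variables (R : realType).
Implicit Types B : star_data R.

Record normed_star_algebra B : Prop := NormedStarAlgebra {
  mul_dom : forall x y, dom B x -> dom B y -> dom B (mul B x y);
  mul_assoc : forall x y z, dom B x -> dom B y -> dom B z ->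
    mul B x (mul B y z) = mul B (mul B x y) z;
  mul_linl : forall (a : R[i]) x y z, dom B x -> dom B y -> dom B z ->
    mul B (a *: x + y) z = a *: mul B x z + mul B y z;
  mul_linr : forall (a : R[i]) x y z, dom B x -> dom B y -> dom B z ->
    mul B z (a *: x + y) = a *: mul B z x + mul B z y;
  norm_mul : forall x y, dom B x -> dom B y ->
    norm B (mul B x y) <= norm B x * norm B y;
  star_dom : forall x, dom B x -> dom B (star B x);
  star_conjlin : forall (a : R[i]) x y, dom B x -> dom B y ->
    star B (a *: x + y) = a^* *: star B x + star B y;
  star_mul : forall x y, dom B x -> dom B y ->
    star B (mul B x y) = mul B (star B y) (star B x);
  star_star : forall x, dom B x -> star B (star B x) = x;
  norm_star : forall x, dom B x -> norm B (star B x) = norm B x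
}.

Definition involutive_banach_algebra (A : completeNormedModType R[i])
    (mulA : A -> A -> A) (starA : A -> A) : Prop :=
  normed_star_algebra (StarData [set: A] (@nrm R A) mulA starA).

Record cstar_algebra B : Prop := CstarAlgebra {
  cstar_banach : banach_on (dom B) (norm B);
  cstar_normed : normed_star_algebra B;
  cstar_identity : forall x, dom B x ->
    norm B (mul B (star B x) x) = norm B x ^+ 2
}.

(* A C*-algebra that is, as a Banach space, the dual of a Banach space. *)
Definition wstar_algebra B : Prop :=
  cstar_algebra B /\
  exists (V : lmodType R[i]) (S : set V) (N : V -> R), banach_on S N /\
  exists j : B -> (V -> R[i]^o),
    [/\ set_bij (dom B) (dual S N) j,
        forall (a : R[i]) x y, dom B x -> dom B y ->
          j (a *: x + y) = a *: j x + j y &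
        forall x, dom B x -> dual_norm S N (j x) = norm B x].

Record isometric_star_isomorphism B1 B2 (f : B1 -> B2) : Prop :=
  IsometricStarIsomorphism {
  iso_bij : set_bij (dom B1) (dom B2) f;
  iso_linear : forall (a : R[i]) x y, dom B1 x -> dom B1 y ->
    f (a *: x + y) = a *: f x + f y;
  iso_mul : forall x y, dom B1 x -> dom B1 y ->
    f (mul B1 x y) = mul B2 (f x) (f y);
  iso_star : forall x, dom B1 x -> f (star B1 x) = star B2 (f x);
  iso_norm : forall x, dom B1 x -> norm B2 (f x) = norm B1 x
}.

End StarAlgebras.

(* f restricts to a homeomorphism of A onto D, for the relative topologies. *)
Definition homeomorphic_on (X Y : topologicalType) (A : set X) (D : set Y)
    (f : X -> Y) : Prop :=
  [/\ set_bij A D f, {within A, continuous f} &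
      exists2 g : Y -> X, {within D, continuous g} &
        forall x, A x -> g (f x) = x].

Section Hilbert.
Variables (R : realType) (H : completeNormedModType R[i]).

(* {dot H for conj}: positive definite, linear in the first variable. *)
Definition hilbert_product (ip : {dot H for Num.conj}) : Prop :=
  forall x : H, ip x x = `|x| ^+ 2.

Variable ip : {dot H for Num.conj}.

Definition bounded_operators : set (H -> H) :=
  [set T | linear T /\ exists M : R, forall x, nrm (T x) <= M * nrm x].

Definition op_norm (T : H -> H) : R :=
  sup [set nrm (T x) | x in [set x : H | nrm x <= 1]].

Definition adjoint (T : H -> H) : H -> H :=
  xget (fun=> 0) [set U : H -> H | forall x y, ip (T x) y = ip x (U y)].

Definition abs_summable (x y : nat -> H) : Prop :=
  cvgn (series (fun n => nrm (x n) * nrm (y n))).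

(* The weak* topology of B(H): the initial topology for the functionals
   T |-> \sum_n <T x_n | y_n> with \sum_n |x_n| |y_n| < +oo. *)
Definition trace_pairing (T : H -> H) :
    {ptws set_type [set z : (nat -> H) * (nat -> H) | abs_summable z.1 z.2]
       -> R[i]^o} :=
  fun z => limn (series (fun n =>
    (ip (T ((set_val z).1 n)) ((set_val z).2 n) : R[i]^o))).

Definition operator_weakstar : topologicalType :=
  initial_topology trace_pairing.

Definition weakstar_closure (M : set (H -> H)) : set (H -> H) :=
  bounded_operators `&` closure (M : set operator_weakstar).

(* A von Neumann subalgebra is a weak*-closed *-subalgebra of B(H); it need not
   contain the identity operator, since representations may be degenerate. *)
Record von_neumann_subalgebra (M : set (H -> H)) : Prop :=
  VonNeumannSubalgebra {
  vn_bounded : M `<=` bounded_operators;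
  vn_zero : M 0;
  vn_lin : forall (a : R[i]) S T, M S -> M T -> M (a *: S + T);
  vn_comp : forall S T, M S -> M T -> M (S \o T);
  vn_adjoint : forall T, M T -> M (adjoint T);
  vn_closed : weakstar_closure M `<=` M
}.

End Hilbert.

(* (T, tens) is the completion of the algebraic tensor product of X and Y for
   the projective norm |u| = inf \sum_i |x_i| |y_i| over u = \sum_i x_i (x) y_i.
   [ptensor_inj] says that the finite sums of elementary tensors in T form an
   algebraic tensor product: a formal sum vanishing in T is killed by every
   bilinear form. *)
Section ProjectiveTensor.
Variables (R : realType) (X Y : normedModType R[i]).
Variables (T : completeNormedModType R[i]) (tens : {bilinear X -> Y -> T}).

Definition tensor_sum (s : seq (X * Y)) : T := \sum_(z <- s) tens z.1 z.2.

Record projective_tensor_product : Prop := ProjectiveTensorProduct {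
  ptensor_inj : forall s, tensor_sum s = 0 ->
    forall b : {bilinear X -> Y -> R[i]^o}, \sum_(z <- s) b z.1 z.2 = 0;
  ptensor_norm : forall s, nrm (tensor_sum s) =
    inf [set \sum_(z <- t) nrm z.1 * nrm z.2 |
          t in [set t | tensor_sum t = tensor_sum s]];
  ptensor_dense : forall (u : T) (e : R), 0 < e ->
    exists s, nrm (u - tensor_sum s) < e
}.

(* The bounded functional on T that linearizes the bounded bilinear form b. *)
Definition ptensor_lift (b : X -> Y -> R[i]) : T -> R[i]^o :=
  xget (fun=> 0) [set f : T -> R[i]^o |
    [/\ linear f, continuous f & forall x y, f (tens x y) = b x y]].

End ProjectiveTensor.

Section Introverted.
Variables (R : realType) (A : completeNormedModType R[i]) (mulA : A -> A -> A).
Implicit Types (phi : A -> R[i]^o).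

Definition nrmA : A -> R := @nrm R A.

Definition Adual : set (A -> R[i]^o) := dual [set: A] nrmA.
Definition Adual_norm : (A -> R[i]^o) -> R := dual_norm [set: A] nrmA.

Definition right_act phi (a : A) : A -> R[i]^o := fun b => phi (mulA a b).

Definition intro_act (mu : (A -> R[i]^o) -> R[i]^o) phi : A -> R[i]^o :=
  fun a => mu (right_act phi a).

Record left_introverted_homogeneous (S : set (A -> R[i]^o))
    (N : (A -> R[i]^o) -> R) : Prop := LeftIntrovertedHomogeneous {
  lih_sub : S `<=` Adual;
  lih_banach : banach_on S N;
  lih_contraction : forall phi, S phi -> Adual_norm phi <= N phi;
  lih_module : forall phi a, S phi ->
    S (right_act phi a) /\ N (right_act phi a) <= N phi * nrm a;
  lih_introverted : forall mu phi, dual S N mu -> S phi ->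
    S (intro_act mu phi) /\ N (intro_act mu phi) <= dual_norm S N mu * N phi
}.

(* The two functionals below are cut off outside S, as required by [dual]. *)
Definition dual_mul (S : set (A -> R[i]^o)) (mu nu : (A -> R[i]^o) -> R[i]^o) :
    (A -> R[i]^o) -> R[i]^o :=
  fun phi => if phi \in S then mu (intro_act nu phi) else 0.

Definition canonical_hom (S : set (A -> R[i]^o)) (a : A) :
    (A -> R[i]^o) -> R[i]^o :=
  fun phi => if phi \in S then phi a else 0.

Variable starA : A -> A.

Definition func_star phi : A -> R[i]^o := fun a => (phi (starA a))^*.

Definition dual_star (mu : (A -> R[i]^o) -> R[i]^o) : (A -> R[i]^o) -> R[i]^o :=
  fun phi => (mu (func_star phi))^*.

Definition dual_star_data (S : set (A -> R[i]^o)) (N : (A -> R[i]^o) -> R) :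
    star_data R :=
  StarData (dual S N) (dual_norm S N) (dual_mul S) dual_star.

End Introverted.

Section Fourier.
Variables (R : realType) (A H : completeNormedModType R[i]).
Variables (mulA : A -> A -> A) (starA : A -> A).
Variables (ip : {dot H for Num.conj}) (pi : A -> H -> H).

Record star_representation : Prop := StarRepresentation {
  rep_bounded : forall a, bounded_operators (pi a);
  rep_linear : forall (c : R[i]) a b, pi (c *: a + b) = c *: pi a + pi b;
  rep_mul : forall a b, pi (mulA a b) = pi a \o pi b;
  rep_star : forall a x y, ip (pi (starA a) x) y = ip x (pi a y)
}.

Definition coef (x y : H) : A -> R[i]^o := fun a => ip (pi a x) y.

(* phi = \sum_n coef x_n y_n, with convergence in sigma(A^*, A). *)
Definition is_coef_sum (x y : nat -> H) (phi : A -> R[i]^o) : Prop :=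
  forall a, series (fun n => coef (x n) (y n) a) @ \oo --> phi a.

Variables (T : completeNormedModType R[i]).
Variable tens : {bilinear H -> conjugate H -> T}.

(* The map p : T -> A^* with p (x (x) dot y) = coef x y. *)
Definition fourier_map (z : T) : A -> R[i]^o :=
  fun a => ptensor_lift tens (fun x (y : conjugate H) => ip (pi a x) y) z.

Definition fourier_space : set (A -> R[i]^o) := range fourier_map.

Definition fourier_norm (phi : A -> R[i]^o) : R :=
  inf [set nrm z | z in [set z | fourier_map z = phi]].

Definition fourier_dual : star_data R :=
  dual_star_data mulA starA fourier_space fourier_norm.

Definition VN : set (H -> H) := weakstar_closure ip (range pi).

Definition VN_data : star_data R :=
  StarData VN (@op_norm R H) (fun S T => S \o T) (adjoint ip).

End Fourier.

(* Main.v *)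
(** An operator [S] pairs with a tensor [u = sum x_n (x) y_n] through
    [tau S u = sum <S x_n | y_n>], and every element of the projective tensor
    product is such a norm-summable series.  Hence the Fourier space is the
    quotient of the tensor product by [K = {u : tau (pi a) u = 0 for all a}],
    with the quotient norm.  By the Riesz theorem a bounded functional on it is
    [tau S] for a unique bounded [S] such that [tau S] vanishes on [K], and its
    norm is the operator norm of [S].

    The weak* closure of [pi A] consists of exactly these [S]: closed conditions
    pass to the closure, and conversely, on any finite set of tensors, [tau S]
    agrees with some [tau (pi a)].  No double commutant theorem is needed, and
    the stability of the condition on [K] under products and adjoints follows by
    moving operators from one side of [<S x_n | y_n>] to the other.  The Arens
    product corresponds to composition because [mu] acts on [sum x_n * y_n] by
    replacing [x_n] with [S x_n].

    That the inclusion into the dual of [A] is contractive rests on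
    [|pi a| <= |a|], which is not assumed but automatic. *)
From HB Require Import structures.
Require Import Defs.
From mathcomp Require Import ring lra.

Set Implicit Arguments.
Unset Strict Implicit.
Unset Printing Implicit Defensive.

Import Order.TTheory GRing.Theory Num.Theory.
Import numFieldNormedType.Exports.

Local Open Scope classical_set_scope.
Local Open Scope ring_scope.

(** * Norms with values in the complex numbers *)

(** The agreement of [tau S] with some [tau (pi a)] on finitely many tensors is exact, for a reason
    of finite-dimensional linear algebra: the tuples of values of all [tau (pi a)] form a linear
    subspace, and if the tuple of [tau S] lay outside it, a linear functional separating the two
    would be a combination [u] of these tensors in [K] with [tau S u <> 0]. The tensor product is
    known only through abstract properties: its elements are limits of finite sums, whose norms are
    infima. The series of almost optimal total must therefore be built by hand; it is also what ties
    the weak* topology of operators, defined through summable pairs of sequences, to the tensor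
    product. The obstacle to contractivity is that no continuity of [pi] is known beforehand. The
    Neumann series of [a^* a] is therefore summed in [A], and only the algebraic identity satisfied
    by its sum is carried over by [pi]. *)

Section RealNorm.
Variables (R : realType) (V : normedModType R[i]).
Implicit Types (x y : V) (u : nat -> V).

Lemma normE x : `|x| = (nrm x)%:C%C.
Proof. by rewrite /nrm; apply/esym/RRe_real/ger0_real. Qed.

Lemma nrm_ge0 x : 0 <= nrm x.
Proof. by rewrite -ler0c -normE. Qed.

Lemma nrm0 : nrm (0 : V) = 0.
Proof. by rewrite /nrm normr0. Qed.

Lemma nrm_eq0 x : nrm x = 0 -> x = 0.
Proof. by move=> x0; apply/normr0_eq0; rewrite normE x0. Qed.

Lemma nrmN x : nrm (- x) = nrm x.
Proof. by rewrite /nrm normrN. Qed.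

Lemma nrmB x y : nrm (x - y) = nrm (y - x).
Proof. by rewrite -nrmN opprB. Qed.

Lemma nrmD x y : nrm (x + y) <= nrm x + nrm y.
Proof. by rewrite -lecR rmorphD /= -!normE ler_normD. Qed.

Lemma nrmC (a : R[i]) : `|a| = (nrm a)%:C%C.
Proof. by rewrite /nrm; apply/esym/RRe_real/ger0_real. Qed.

Lemma nrmZ (a : R[i]) x : nrm (a *: x) = nrm a * nrm x.
Proof. by apply: complexI; rewrite rmorphM /= -!normE -nrmC normrZ. Qed.

Lemma nrm_sum I (r : seq I) (P : pred I) (f : I -> V) :
  nrm (\sum_(i <- r | P i) f i) <= \sum_(i <- r | P i) nrm (f i).
Proof.
elim/big_ind2: _ => [||//]; first by rewrite nrm0.
by move=> x a y b xa yb; apply: le_trans (nrmD _ _) _; apply: lerD.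
Qed.

(** Neighbourhoods of [l] are measured by positive elements of [R[i]], which are real; this passes
    to real-valued norms, where squeezing and comparison of series take place. *)
Lemma cvg_nrmP T (F : set_system T) {FF : Filter F} (f : T -> V) (l : V) :
  f @ F --> l <-> nrm (f t - l) @[t --> F] --> (0 : R).
Proof.
split=> [/cvgrPdist_lt fl | /cvgrPdist_lt fl]; apply/cvgrPdist_lt => e e0.
- have /fl : 0 < e%:C%C by rewrite ltcR.
  apply: filterS => t; rewrite normE ltcR => te.
  by rewrite sub0r normrN ger0_norm ?nrm_ge0// nrmB.
- have eR : e = (complex.Re e)%:C%C by rewrite RRe_real// gtr0_real.
  have /fl : 0 < complex.Re e by rewrite -ltcR -eR.
  apply: filterS => t; rewrite sub0r normrN ger0_norm ?nrm_ge0// => te.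
  by rewrite normE eR ltcR nrmB.
Qed.

Lemma cvg_nrm T (F : set_system T) {FF : Filter F} (f : T -> V) (l : V) :
  f @ F --> l -> nrm (f t) @[t --> F] --> nrm l.
Proof.
move=> /cvg_nrmP/cvgrPdist_lt fl; apply/cvgrPdist_lt => e /fl.
apply: filterS => t; rewrite sub0r normrN ger0_norm ?nrm_ge0//.
apply: le_lt_trans; have := nrmD (f t - l) l; have := nrmD (l - f t) (f t).
rewrite !subrK (nrmB l) => h1 h2.
by rewrite ler_norml; apply/andP; split; lra.
Qed.
End RealNorm.

Section Squeeze.
Variables (R : realType).
Lemma cvg0_le T (F : set_system T) {FF : Filter F} (f g : T -> R) :
  (forall t, 0 <= f t) -> (forall t, f t <= g t) -> g @ F --> (0:R) -> f @ F --> (0:R).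
Proof.
move=> f0 fg /cvgrPdist_lt g0; apply/cvgrPdist_lt => e /g0.
apply: filterS => t; rewrite !sub0r !normrN !ger0_norm//; first exact: le_lt_trans.
exact: le_trans (fg t).
Qed.

Lemma cvg0_leM T (F : set_system T) {FF : Filter F} (M : R) (f g : T -> R) :
  (forall t, 0 <= f t) -> (forall t, f t <= M * g t) -> g @ F --> (0:R) -> f @ F -->
    (0:R).
Proof.
move=> f0 fg g0; apply: cvg0_le f0 fg _; rewrite -[0](mulr0 M).
by apply: cvgM => //; exact: cvg_cst.
Qed.

Lemma cvgn0P (f : nat -> R) : (forall n, 0 <= f n) ->
  f @ \oo --> (0 : R) <-> forall e, 0 < e -> exists N, forall n, (N <= n)%N -> f n < e.
Proof.
move=> f0; split=> [/cvgrPdist_lt fl e /fl [N _ fN]|fl].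
- exists N => n Nn; have := fN _ Nn.
  by rewrite /= sub0r normrN ger0_norm.
- apply/cvgrPdist_lt => e /fl[N fN]; exists N => // n /fN.
  by rewrite sub0r normrN ger0_norm.
Qed.
End Squeeze.

(** The norms below are infima, attained only up to a slack [e] that then gets multiplied by [c]. As
    [c] may be 0, the slack is chosen as [e / (c + 1)]. *)
Lemma ler_mul_eps (R : realType) (X Y c : R) : 0 <= c ->
  (forall e, 0 < e -> X <= c * (Y + e)) -> X <= c * Y.
Proof.
move=> c0 h; apply/ler_addgt0Pr => e e0.
have c1 : 0 < c + 1 by rewrite ltr_wpDl.
apply: le_trans (h _ (divr_gt0 e0 c1)) _; rewrite mulrDr lerD2l.
by rewrite mulrCA ler_piMr ?(ltW e0)// ler_pdivrMr// mul1r lerDl.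
Qed.

Lemma nrmM (R : realType) (a b : R[i]) : nrm (a * b) = nrm a * nrm b.
Proof. exact: (nrmZ a (b : R[i]^o)). Qed.

Lemma nrm_conj (R : realType) (a : R[i]) : nrm a^* = nrm a.
Proof. by rewrite /nrm norm_conjC. Qed.

Lemma nrm_real (R : realType) (a : R) : nrm a%:C%C = `|a|.
Proof. by rewrite /nrm normc_def /= expr0n addr0 sqrtr_sqr. Qed.

Lemma Re_le_nrm (R : realType) (a : R[i]) : `|complex.Re a| <= nrm a.
Proof. by rewrite -lecR -nrmC normc_ge_Re. Qed.

(** * Completeness of the complex numbers and absolutely convergent series *)

Section CompleteC.
Variables (R : realType).
Local Notation C := R[i].

Lemma Im_le_nrm (a : C) : `|complex.Im a| <= nrm a.
Proof.
rewrite /nrm normc_def /= -sqrtr_sqr ler_sqrt ?lerDr ?addr_ge0 ?sqr_ge0//.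
Qed.

Lemma nrm_le_ReIm (a : C) : nrm a <= `|complex.Re a| + `|complex.Im a|.
Proof.
rewrite /nrm normc_def /= -[leRHS]ger0_norm ?addr_ge0// -sqrtr_sqr.
rewrite ler_sqrt ?sqr_ge0// sqrrD !real_normK ?num_real//.
by rewrite -addrA [_ *+ 2 + _]addrC addrA lerDl mulrn_wge0// mulr_ge0.
Qed.

Lemma complexR_complete (F : set_system C^o) : ProperFilter F -> cauchy F -> cvg F.
Proof.
move=> FF /cauchy_ballP F_cauchy.
(* Real and imaginary parts are additive and contractive, so they carry a Cauchy filter to Cauchy
   filters on the reals. *)
have key (p : {additive C -> R}) : (forall a, `|p a| <= nrm a) -> cvg (p @ F).
  move=> pn; apply: R_complete.
  apply/cauchy_ballP => e e0.
  have e0' : 0 < e%:C%C by rewrite ltcR.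
  have := F_cauchy _ e0'.
  rewrite !near_simpl; case=> -[A B] /= [FA FB AB].
  exists (p @` A, p @` B) => /=.
    by split; [apply: filterS FA|apply: filterS FB] => x; exists x.
  move=> [_ _] /= [[x Ax <-] [y By <-]].
  have := AB (x, y) (conj Ax By).
  rewrite /= /ball /= /ball_ /= nrmC ltcR; apply: le_lt_trans.
  by rewrite -raddfB.
have kr : cvg ((@complex.Re R : C -> R) @ F) := key (@complex.Re R) (@Re_le_nrm R).
have ki : cvg ((@complex.Im R : C -> R) @ F) := key (@complex.Im R) Im_le_nrm.
apply/cvg_ex.
exists (lim ((@complex.Re R : C -> R) @ F) +i* lim ((@complex.Im R : C -> R) @ F))%C.
set a := lim _ in kr *; set b := lim _ in ki *.
apply/(@cvg_nrmP _ _ _ F _ id).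
have -> : (0:R) = `|a - a| + `|b - b| by rewrite !subrr normr0 addr0.
have : `|complex.Re t - a| + `|complex.Im t - b| @[t --> F] --> `|a - a| + `|b - b|.
  by apply: cvgD; apply: cvg_norm; apply: cvgB => //; apply: cvg_cst.
rewrite !subrr !normr0 !addr0; apply: cvg0_le => t; first exact: nrm_ge0.
by apply: le_trans (nrm_le_ReIm _) _; case: t.
Qed.

End CompleteC.

Section Cauchy.
Variable (R : realType).

Definition cauchy_seq (V : normedModType R[i]) (u : nat -> V) := forall e, 0 < e ->
  exists N, forall m n, (N <= m)%N -> (N <= n)%N -> nrm (u m - u n) < e.

(* [R[i]^o] carries no canonical complete structure, so completeness is stated
   for sequences to cover both it and the Banach spaces. *)
Definition seq_complete (V : normedModType R[i]) := forall u : nat -> V,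
  cauchy_seq u -> cvgn u.

Lemma cauchy_seq_cauchy (V : normedModType R[i]) (u : nat -> V) :
  cauchy_seq u -> cauchy (u @ \oo).
Proof.
move=> cu; apply/cauchy_ballP => e e0.
have eR : e = (complex.Re e)%:C%C by rewrite RRe_real// gtr0_real.
have /cu [N uN] : 0 < complex.Re e by rewrite -ltcR -eR.
exists ([set u n | n in [set n | (N <= n)%N]], [set u n | n in [set n | (N <= n)%N]])
  => /=.
  by split; exists N => // n Nn; exists n.
move=> [_ _] /= [[m Nm <-] [n Nn <-]].
by rewrite -ball_normE /ball_ /= normE eR ltcR uN.
Qed.

Lemma seq_complete_banach (V : completeNormedModType R[i]) : seq_complete V.
Proof. by move=> u cu; apply: cauchy_cvg; exact: cauchy_seq_cauchy. Qed.

Lemma seq_complete_complex : seq_complete R[i]^o.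
Proof. by move=> u cu; apply: complexR_complete; exact: cauchy_seq_cauchy. Qed.

Lemma cauchy_series (V : normedModType R[i]) (u : nat -> V) :
  cvgn (series (fun n => nrm (u n))) -> cauchy_seq (series u).
Proof.
move=> /cauchy_cvgP/cauchy_seriesP us e /us [[A B] /=] [[N1 _ A1] [N2 _ B2]] AB.
have aux m n : (maxn N1 N2 <= m)%N -> (m <= n)%N -> nrm (series u n - series u m) < e.
  rewrite geq_max => /andP[m1 m2] mn.
  rewrite sub_series_geq//; apply: le_lt_trans (nrm_sum _ _ _) _.
  have := AB (m, n) (conj (A1 _ m1) (B2 _ (leq_trans m2 mn))).
  by apply: le_lt_trans; rewrite ler_norm.
exists (maxn N1 N2) => m n Nm Nn.
by case/orP: (leq_total m n) => mn; [rewrite nrmB|]; apply: aux.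
Qed.

Lemma nrm_lim_le (V : normedModType R[i]) (u : nat -> V) (l : V) (M : R) :
  u @ \oo --> l -> (forall n, nrm (u n) <= M) -> nrm l <= M.
Proof.
move=> /cvg_nrm ul uM; rewrite -(cvg_lim (@Rhausdorff R) ul).
by apply: limr_le; [apply: cvgP ul|apply: nearW].
Qed.

Lemma series_nrm_le (V : normedModType R[i]) (u : nat -> V) (l : V) (M : R) :
  series u @ \oo --> l -> (forall n, series (fun n => nrm (u n)) n <= M) -> nrm l <= M.
Proof.
move=> /nrm_lim_le ul uM; apply: ul => n.
by apply: le_trans (uM n); exact: nrm_sum.
Qed.

Lemma nneg_series_cvg (f : nat -> R) (M : R) : (forall n, 0 <= f n) ->
  (forall n, series f n <= M) -> cvgn (series f) /\ limn (series f) <= M.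
Proof.
move=> f0 fM.
have c : cvgn (series f).
  apply: nondecreasing_is_cvgn; first exact: nondecreasing_series.
  by exists M => _ [n _ <-].
by split=> //; apply: limr_le => //; apply: nearW.
Qed.

Lemma nneg_series_le (f : nat -> R) n : (forall n, 0 <= f n) ->
  cvgn (series f) -> series f n <= limn (series f).
Proof.
by move=> f0 cf; apply: nondecreasing_cvgn_le => //; exact: nondecreasing_series.
Qed.

End Cauchy.

(** * Bounded operators on a Hilbert space *)

Section UnitSup.
Variables (R : realType) (V : lmodType R[i]) (S : set V) (N g : V -> R).
Hypothesis hS : banach_on S N.

Lemma banach_onZ a x : S x -> S (a *: x).
Proof.
by move=> Sx; rewrite -[_ *: _]addr0; apply: (banach_onP hS) => //;
  exact: banach_on0 hS.
Qed.

Lemma banach_onD x y : S x -> S y -> S (x + y).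
Proof. by move=> Sx; rewrite -[x]scale1r; exact: (banach_onP hS). Qed.

Lemma banach_onN x : S x -> S (- x).
Proof. by rewrite -scaleN1r; exact: banach_onZ. Qed.

Lemma banach_onB x y : S x -> S y -> S (x - y).
Proof. by move=> Sx Sy; apply: banach_onD => //; exact: banach_onN. Qed.

Lemma banach_on_normN x : S x -> N (- x) = N x.
Proof.
move=> Sx; rewrite -scaleN1r (banach_on_normZ hS)//.
by rewrite /nrm normrN1 mul1r.
Qed.

Lemma banach_on_norm00 : N 0 = 0.
Proof.
rewrite -(scale0r (0 : V)) (banach_on_normZ hS); last exact: banach_on0 hS.
by rewrite /nrm normr0 mul0r.
Qed.

Lemma banach_on_norm_ge0 x : S x -> 0 <= N x.
Proof.
move=> Sx; have := banach_on_normD hS Sx (banach_onN Sx).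
by rewrite subrr banach_on_norm00 banach_on_normN//; lra.
Qed.

Hypothesis gZ : forall (a : R[i]) x, S x -> g (a *: x) = nrm a * g x.
Hypothesis g0 : forall x, S x -> 0 <= g x.

Let B := [set g x | x in [set x | S x /\ N x <= 1]].

(** The operator norm and the dual norm are both suprema of an absolutely homogeneous function [g]
    over a unit ball, so their basic estimates are proved once for both. *)
Lemma unit_sup_le M : 0 <= M -> (forall x, S x -> g x <= M * N x) -> sup B <= M.
Proof.
move=> M0 gM; apply: ge_sup.
  by exists (g 0); exists 0 => //; split; [exact: banach_on0 hS|rewrite
    banach_on_norm00].
by move=> _ [x [Sx Nx] <-]; apply: le_trans (gM _ Sx) _; rewrite ler_piMr.
Qed.

Variable M : R.
Hypothesis gM : forall x, S x -> g x <= M * N x.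

Let B_ub : ubound B `|M|.
Proof.
move=> _ [x [Sx Nx] <-]; apply: le_trans (gM Sx) _.
have Nx0 := banach_on_norm_ge0 Sx.
have := ler_norm M; have := normr_ge0 M; nra.
Qed.

Lemma unit_sup_ub x : S x -> g x <= sup B * N x.
Proof.
move=> Sx; have Nx0 := banach_on_norm_ge0 Sx.
(* Rescaling to the unit ball requires [N x] to be nonzero; otherwise the bound [gM] alone gives the
   inequality. *)
have [Nx|Nx] := eqVneq (N x) 0; first by have := gM Sx; rewrite Nx !mulr0.
have Nx_gt0 : 0 < N x by rewrite lt_neqAle eq_sym Nx.
have nV : nrm ((N x)^-1%:C%C) = (N x)^-1.
  by rewrite nrm_real ger0_norm// invr_ge0.
have := ub_le_sup (ex_intro _ _ B_ub) (x := g ((N x)^-1%:C%C *: x)).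
rewrite gZ// nV -ler_pdivrMr// mulrC; apply.
exists ((N x)^-1%:C%C *: x); last by rewrite gZ// nV mulrC.
split; first exact: banach_onZ.
by rewrite (banach_on_normZ hS)// nV mulVf.
Qed.

Lemma unit_sup_ge0 : 0 <= sup B.
Proof.
have S0 := banach_on0 hS.
apply: le_trans (g0 S0) _; apply: ub_le_sup; first by exists `|M|.
by exists 0 => //; split=> //; rewrite banach_on_norm00.
Qed.

End UnitSup.

Section BanachTop.
Variables (R : realType) (V : completeNormedModType R[i]).

Lemma banach_on_setT : banach_on [set: V] (@nrm R V).
Proof.
split=> //; first by move=> x _; exact: nrm_eq0.
- by move=> x y _ _; exact: nrmD.
- by move=> a x _; exact: nrmZ.
- move=> u _ /(@seq_complete_banach _ _ u) cu.
  by exists (limn u) => //; apply/cvg_nrmP.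
Qed.

End BanachTop.

Lemma ReD (R : realType) (a b : R[i]) :
  complex.Re (a + b) = complex.Re a + complex.Re b.
Proof. by case: a b => [? ?] [? ?]. Qed.

Lemma ReB (R : realType) (a b : R[i]) :
  complex.Re (a - b) = complex.Re a - complex.Re b.
Proof. by case: a b => [? ?] [? ?]. Qed.

(** * The Cauchy-Schwarz inequality and the Riesz representation theorem *)

Section Hilbert.
Variables (R : realType) (H : completeNormedModType R[i]) (ip : {dot H for Num.conj}).
Hypothesis hH : hilbert_product ip.
Local Notation C := R[i].
Implicit Types (x y z : H) (S T : H -> H).

Lemma ip_conj x y : (ip x y)^* = ip y x.
Proof. by rewrite [ip y x]hermC /= expr0 mul1r. Qed.

Lemma ipDl x y z : ip (x + y) z = ip x z + ip y z.
Proof. exact: linearDl. Qed.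
Lemma ipDr x y z : ip x (y + z) = ip x y + ip x z.
Proof. exact: linearDr. Qed.
Lemma ipBl x y z : ip (x - y) z = ip x z - ip y z.
Proof. exact: linearBl. Qed.
Lemma ipBr x y z : ip x (y - z) = ip x y - ip x z.
Proof. exact: linearBr. Qed.
Lemma ipZl a x y : ip (a *: x) y = a * ip x y.
Proof. exact: linearZl_LR. Qed.
Lemma ipZr a x y : ip x (a *: y) = a^* * ip x y.
Proof. exact: linearZr_LR. Qed.
Lemma ip0l x : ip 0 x = 0.
Proof. exact: linear0l. Qed.
Lemma ip0r x : ip x 0 = 0.
Proof. exact: linear0r. Qed.

Lemma ipE x : ip x x = (nrm x ^+ 2)%:C%C.
Proof. by rewrite hH normE rmorphXn. Qed.

(** The vector [|y|^2 x - <x|y> y] is [|y|^2] times the component of [x] orthogonal to [y]. Its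
    squared norm is nonnegative and equals [|y|^2 (|y|^2 |x|^2 - |<x|y>|^2)]. *)
Lemma CSineq x y : nrm (ip x y) <= nrm x * nrm y.
Proof.
have [->|y0] := eqVneq y 0; first by rewrite ip0r !nrm0 mulr0 /nrm normr0.
have ny : 0 < nrm y.
  by rewrite lt_neqAle nrm_ge0 andbT eq_sym; apply: contra_neq y0 => /nrm_eq0.
have : ip ((nrm y ^+ 2)%:C%C *: x - ip x y *: y) ((nrm y ^+ 2)%:C%C *: x - ip x y *: y)
     = (nrm y ^+ 2 * (nrm y ^+ 2 * nrm x ^+ 2 - nrm (ip x y) ^+ 2))%:C%C.
  rewrite !(ipBl, ipBr, ipZl, ipZr) !ipE.
  have -> : ((nrm y ^+ 2)%:C%C : C)^* = (nrm y ^+ 2)%:C%C by exact: conjc_real.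
  rewrite [RHS]rmorphM rmorphB rmorphM [X in _ * (_ - X)]rmorphXn /=.
  rewrite -nrmC normCK ip_conj; ring.
rewrite ipE => /complexI/eqP h.
have : 0 <= nrm y ^+ 2 * (nrm y ^+ 2 * nrm x ^+ 2 - nrm (ip x y) ^+ 2).
  by rewrite -(eqP h) sqr_ge0.
rewrite pmulr_rge0 ?exprn_gt0// subr_ge0 -exprMn mulrC ler_pXn2r// nnegrE ?mulr_ge0
  ?nrm_ge0//.
by rewrite /nrm -ler0c -nrmC.
Qed.

Definition rip x y : R := complex.Re (ip x y).

Lemma nrm_sqrD x y : nrm (x + y) ^+ 2 = nrm x ^+ 2 + 2 * rip x y + nrm y ^+ 2.
Proof.
apply: complexI; rewrite -ipE !(ipDl, ipDr) !ipE -(ip_conj x y).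
have := addcJ (ip x y); rewrite -(rmorph_nat (real_complex R)) => h.
rewrite [RHS]rmorphD [X in _ = X + _]rmorphD [X in _ = _ + X + _]rmorphM -h; ring.
Qed.

Lemma ripZl (t : R) x y : rip (t%:C%C *: x) y = t * rip x y.
Proof. by rewrite /rip ipZl; case: (ip x y) => a b /=; rewrite mul0r subr0. Qed.

Lemma ripC x y : rip x y = rip y x.
Proof. by rewrite /rip -(ip_conj y x); case: (ip y x). Qed.

Lemma nrm_realZ (t : R) x : nrm (t%:C%C *: x) ^+ 2 = t ^+ 2 * nrm x ^+ 2.
Proof. by rewrite nrmZ nrm_real exprMn real_normK ?num_real. Qed.

Lemma parallelogram x y :
  nrm (x - y) ^+ 2 = 2 * nrm x ^+ 2 + 2 * nrm y ^+ 2 - 4 * nrm ((2^-1)%:C%C *: (x + y))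
    ^+ 2.
Proof.
rewrite nrm_realZ !nrm_sqrD nrmN.
have -> : rip x (- y) = - rip x y.
  by rewrite /rip; have -> : ip x (- y) = - ip x y by [exact: linearNr]; rewrite raddfN.
by field.
Qed.

(* The representing vector minimizes [|x|^2 - 2 Re f(x)]. *)
Lemma riesz (f : H -> C) (M : R) : (forall a x y, f (a *: x + y) = a * f x + f y) ->
  (forall x, nrm (f x) <= M * nrm x) -> exists y, forall x, f x = ip x y.
Proof.
move=> fl fM.
have f0 : f 0 = 0 by have := fl 1 0 0; rewrite scale1r addr0 mul1r => /esym/(canRL
  (addrK _)); rewrite subrr.
have fD x y : f (x + y) = f x + f y by rewrite -[x]scale1r fl mul1r scale1r.
have fZ a x : f (a *: x) = a * f x by rewrite -[_ *: _]addr0 fl f0 addr0.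
have fB x y : f (x - y) = f x - f y by rewrite fD -scaleN1r fZ mulN1r.
have fZr (t : R) x : complex.Re (f (t%:C%C *: x)) = t * complex.Re (f x).
  by rewrite fZ; case: (f x) => a b /=; rewrite mul0r subr0.
pose J x := nrm x ^+ 2 - 2 * complex.Re (f x).
(* [J x >= |x|^2 - 2 M |x| = (|x| - M)^2 - M^2]. *)
have Jlb : lbound (range J) (- M ^+ 2).
  move=> _ [x _ <-]; rewrite /J; have := Re_le_nrm (f x); have := fM x.
  have := ler_norm (complex.Re (f x)); have := nrm_ge0 x => h1 h2 h3 h4.
  have : complex.Re (f x) <= M * nrm x by lra.
  by have := sqr_ge0 (nrm x - M); rewrite sqrrB mulr_natl; lra.
have hJ : has_inf (range J) by split; [exists (J 0); exists 0|exists (- M ^+ 2)].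
set d := inf (range J).
have dJ x : d <= J x by apply: ge_inf; [exists (- M ^+ 2)|exists x].
have /choice[u hu] : forall n, exists x, J x < d + n.+1%:R^-1.
  move=> n; have [_ [x _ <-] xd] := inf_adherent (ltac:(by rewrite invr_gt0 ltr0n) : 0
    < n.+1%:R^-1 :> R) hJ.
  by exists x.
(* In the parallelogram law the linear parts of [J] cancel, so the left side is
   [2 J(u_m) + 2 J(u_n) - 4 J(midpoint)], and [J] is at least [d] at the midpoint. Hence minimizing
   sequences are Cauchy. *)
have uu m n : nrm (u m - u n) ^+ 2 <= 2 * m.+1%:R^-1 + 2 * n.+1%:R^-1.
  rewrite parallelogram.
  have := dJ ((2^-1)%:C%C *: (u m + u n)); rewrite {1}/J fZr fD ReD.
  move: (hu m) (hu n); rewrite /J.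
  move: (m.+1%:R^-1) (n.+1%:R^-1) => a b; lra.
have cu : cauchy_seq u.
  move=> e e0.
  have e4 : 0 < e ^+ 2 / 4 by rewrite divr_gt0 ?exprn_gt0.
  have [N _ hN] := near_infty_natSinv_lt (PosNum e4).
  exists N => m n /hN /= m4 /hN /= n4.
  have := uu m n => h.
  have : nrm (u m - u n) ^+ 2 < e ^+ 2.
    by move: m4 n4 h; move: (m.+1%:R^-1) (n.+1%:R^-1) => a b; lra.
  by rewrite ltr_pXn2r// nnegrE ?nrm_ge0// ltW.
have [y uy] : exists y, u @ \oo --> y by exists (limn u); apply: seq_complete_banach.
exists y.
have Ju : (J \o u) @ \oo --> J y.
  apply: cvgB; first by apply: cvgM; apply: cvg_nrm.
  apply: cvgMr; apply/cvgrPdist_le => e e0.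
  have M1 : 0 < `|M| + 1 by rewrite ltr_wpDl.
  move/cvg_nrmP/cvgrPdist_lt : uy => /(_ (e / (`|M| + 1))) [];
    first by rewrite divr_gt0.
  move=> N _ hN; exists N => // n /hN /=.
  rewrite sub0r normrN ger0_norm ?nrm_ge0// ltr_pdivlMr// => h.
  rewrite -ReB -fB; apply: le_trans (Re_le_nrm _) _.
  apply: le_trans (fM _) _; rewrite nrmB.
  have := ler_norm M; have := nrm_ge0 (u n - y); nra.
have Jy : J y <= d.
  have hd : (fun n => d + n.+1%:R^-1 : R) @ \oo --> d + 0.
    apply: cvgD; [exact: cvg_cst | exact: (@cvg_harmonic R)].
  rewrite addr0 in hd.
  apply: (ler_cvg_to Ju hd); apply: nearW => n; exact: ltW (hu n).
have Re_eq h : complex.Re (f h) = rip h y.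
  (* This is [J (y + t h) - J y >= 0], because [y] is a minimizer. *)
  have key (t : R) : 0 <= 2 * t * (rip h y - complex.Re (f h)) + t ^+ 2 * nrm h ^+ 2.
    have := le_trans Jy (dJ (y + t%:C%C *: h)).
    rewrite /J nrm_sqrD nrm_realZ fD ReD fZr (ripC y) ripZl; lra.
  set a := rip h y - _ in key; set b := nrm h ^+ 2 in key.
  have b0 : 0 <= b by rewrite sqr_ge0.
  (* The quadratic [2 t a + t^2 b] is smallest at [t = - a / b]; the denominator [b + 1] keeps the
     value negative for nonzero [a] and also covers [b = 0]. *)
  have := key (- a / (b + 1)).
  have -> : 2 * (- a / (b + 1)) * a + (- a / (b + 1)) ^+ 2 * b =
     - (a ^+ 2 * (b + 2) / (b + 1) ^+ 2) by field; rewrite gt_eqF// ltr_wpDl.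
  rewrite oppr_ge0 ler_pdivrMr ?exprn_gt0 ?ltr_wpDl// mul0r pmulr_lle0 ?ltr_wpDl//.
  move=> a2; have /eqP : a ^+ 2 == 0 by rewrite eq_le a2 sqr_ge0.
  by move/eqP; rewrite sqrf_eq0 subr_eq0 => /eqP.
(* The real part at [i x] is minus the imaginary part at [x], so equality of real parts everywhere
   gives equality. *)
move=> x; have := Re_eq ('i%C *: x); have := Re_eq x.
rewrite fZ /rip ipZl; case: (f x) => a b; case: (ip x y) => a' b' /= -> .
by rewrite !mul0r !mul1r !sub0r => /oppr_inj ->.
Qed.

End Hilbert.

(** * Bounded operators, adjoints and the C*-identity *)

Section Operators.
Variables (R : realType) (H : completeNormedModType R[i]).
Implicit Types (x y z : H) (S T : H -> H).
Local Notation B := (@bounded_operators R H).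

Lemma op_norm_unit_sup T :
  op_norm T = sup [set nrm (T x) | x in [set x | [set: H] x /\ nrm x <= 1]].
Proof.
congr sup; congr image; rewrite predeqE => x.
by split=> [|[]//].
Qed.

Lemma bopP T : B T -> forall a x y, T (a *: x + y) = a *: T x + T y.
Proof. by case. Qed.

Lemma bop0 T : B T -> T 0 = 0.
Proof.
move=> /bopP/(_ 1 0 0); rewrite !scale1r addr0 => /esym/(canRL (addrK _)).
by rewrite subrr.
Qed.

Lemma bopZ T a x : B T -> T (a *: x) = a *: T x.
Proof. by move=> BT; rewrite -[_ *: _]addr0 bopP// bop0// addr0. Qed.

Lemma bopD T x y : B T -> T (x + y) = T x + T y.
Proof. by move=> BT; rewrite -[x]scale1r bopP// !scale1r. Qed.

Lemma bopB T x y : B T -> T (x - y) = T x - T y.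
Proof. by move=> BT; rewrite -scaleN1r bopD// bopZ// scaleN1r. Qed.

Lemma op_norm_ge0 T : B T -> 0 <= op_norm T.
Proof.
move=> [Tl [M TM]]; rewrite op_norm_unit_sup.
apply: (@unit_sup_ge0 _ _ _ _ _ (banach_on_setT H) _ M) => x _;
  [exact: nrm_ge0|exact: TM].
Qed.

Lemma op_normP T x : B T -> nrm (T x) <= op_norm T * nrm x.
Proof.
move=> BT; have [_ [M TM]] := BT; rewrite op_norm_unit_sup.
apply: (@unit_sup_ub _ _ _ _ (fun x => nrm (T x)) (banach_on_setT H) _ M) => //.
by move=> a y _; rewrite bopZ// nrmZ.
Qed.

Lemma op_norm_le T M : 0 <= M -> (forall x, nrm (T x) <= M * nrm x) ->
  op_norm T <= M.
Proof.
move=> M0 TM; rewrite op_norm_unit_sup.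
exact: (unit_sup_le (banach_on_setT H)).
Qed.

Lemma fun_linE a S T x : (a *: S + T) x = a *: S x + T x.
Proof. by []. Qed.

Lemma bounded_lin a S T : B S -> B T -> B (a *: S + T).
Proof.
move=> BS BT; split.
  move=> b x y; rewrite !fun_linE (bopP BS) (bopP BT) !scalerDr !scalerA mulrC.
  by rewrite addrACA.
exists (nrm a * op_norm S + op_norm T) => x.
rewrite fun_linE; apply: le_trans (nrmD _ _) _; rewrite mulrDl lerD ?op_normP//.
rewrite nrmZ -mulrA ler_wpM2l ?op_normP//.
exact: (nrm_ge0 (a : R[i]^o)).
Qed.

Lemma bounded0 : B 0.
Proof.
split; first by move=> a x y; rewrite scaler0 addr0.
by exists 0 => x; rewrite mul0r nrm0.
Qed.

Lemma bounded_comp S T : B S -> B T -> B (S \o T).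
Proof.
move=> BS BT; split; first by move=> a x y; rewrite /= !bopP.
exists (op_norm S * op_norm T) => x /=; rewrite -mulrA.
by apply: le_trans (op_normP _ BS) _; rewrite ler_wpM2l ?op_normP ?op_norm_ge0.
Qed.

Lemma op_norm_comp S T : B S -> B T -> op_norm (S \o T) <= op_norm S * op_norm T.
Proof.
move=> BS BT; apply: op_norm_le => [|x /=]; first by rewrite mulr_ge0 ?op_norm_ge0.
rewrite -mulrA.
by apply: le_trans (op_normP _ BS) _; rewrite ler_wpM2l ?op_normP ?op_norm_ge0.
Qed.

Variable ip : {dot H for Num.conj}.
Hypothesis hH : hilbert_product ip.

Lemma ip_injr y z : (forall x, ip x y = ip x z) -> y = z.
Proof.
move=> h; apply/eqP; rewrite -subr_eq0; apply/eqP/nrm_eq0.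
have := h (y - z); move/eqP; rewrite -subr_eq0 -(ipBr ip) (ipE hH) => /eqP.
by move=> /(@complexI R _ 0)/eqP; rewrite sqrf_eq0 => /eqP.
Qed.

Lemma ip_injl y z : (forall x, ip y x = ip z x) -> y = z.
Proof. by move=> h; apply: ip_injr => x; rewrite -!(ip_conj ip _ x) h. Qed.

Lemma op_eq S T : (forall x y, ip (S x) y = ip (T x) y) -> S = T.
Proof. by move=> h; apply: funext => x; exact: ip_injl. Qed.

Lemma nrm_le_ip (M : R) y : 0 <= M -> (forall x, nrm (ip x y) <= M * nrm x) -> nrm y <=
  M.
Proof.
move=> M0 /(_ y); rewrite (ipE hH) nrm_real ger0_norm ?sqr_ge0// expr2.
have := nrm_ge0 y; rewrite le_eqVlt => /predU1P[<-//|y0].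
by rewrite ler_pM2r.
Qed.

(** For fixed [x] the map [y |-> (b x y)^*] is linear and bounded; its Riesz vector is [S x]. The
    lemma produces both adjoints and the operators attached to functionals on the Fourier space. *)
Lemma bounded_form (b : H -> H -> R[i]) (M : R) : 0 <= M ->
  (forall a x y z, b (a *: x + y) z = a * b x z + b y z) ->
  (forall a x y z, b z (a *: x + y) = a^* * b z x + b z y) ->
  (forall x y, nrm (b x y) <= M * nrm x * nrm y) ->
  exists S, [/\ forall x y, ip (S x) y = b x y,
    B S & forall x, nrm (S x) <= M * nrm x].
Proof.
move=> M0 bl br bM.
have /choice[S hS] x : exists s, forall y, (b x y)^* = ip y s.
  apply: (riesz hH (f := fun y => (b x y)^*) (M := M * nrm x)) => [a y z|y].
    by rewrite br rmorphD rmorphM /= conjCK.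
  by rewrite nrm_conj.
have hS' x y : ip (S x) y = b x y by rewrite -(ip_conj ip y) -hS conjCK.
have Sle x : nrm (S x) <= M * nrm x.
  apply: nrm_le_ip => [|y]; first by rewrite mulr_ge0 ?nrm_ge0.
  by rewrite -hS nrm_conj.
exists S; split=> //; split; last by exists M.
by move=> a x y; apply: ip_injl => z; rewrite (ipDl ip) (ipZl ip) !hS' bl.
Qed.

(** [adjoint] is a choice with a default value, so its defining property has to come from existence,
    here from the form [<x | T y>]. *)
Lemma adjointP T : B T -> forall x y, ip (T x) y = ip x (adjoint ip T y).
Proof.
move=> BT; rewrite /adjoint.
have [U [hU BU _]] : exists S, [/\ forall x y, ip (S x) y = ip x (T y),
    B S & forall x, nrm (S x) <= op_norm T * nrm x].
  apply: bounded_form; first exact: op_norm_ge0.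
  - by move=> a x y z; rewrite (ipDl ip) (ipZl ip).
  - by move=> a x y z; rewrite bopP// (ipDr ip) (ipZr ip).
  - move=> x y; apply: le_trans (CSineq hH _ _) _.
    by rewrite mulrAC mulrC ler_wpM2r ?nrm_ge0 ?op_normP.
have : [set U : H -> H | forall x y, ip (T x) y = ip x (U y)] U.
  by move=> x y; rewrite -(ip_conj ip y) -(ip_conj ip _ x) hU.
by move/(@xgetI _ (fun=> 0)).
Qed.

Lemma adjoint_uniq T U : B T -> (forall x y, ip (T x) y = ip x (U y)) -> adjoint ip T =
  U.
Proof.
move=> BT TU; apply: funext => y; apply: ip_injr => x.
by rewrite -adjointP.
Qed.

Lemma adjoint_bound T y : B T -> nrm (adjoint ip T y) <= op_norm T * nrm y.
Proof.
move=> BT; apply: nrm_le_ip => [|x]; first by rewrite mulr_ge0 ?nrm_ge0 ?op_norm_ge0.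
rewrite -adjointP//; apply: le_trans (CSineq hH _ _) _.
by rewrite mulrAC ler_wpM2r ?nrm_ge0 ?op_normP.
Qed.

Lemma adjoint_bounded T : B T -> B (adjoint ip T).
Proof.
move=> BT; split; last by exists (op_norm T) => y; exact: adjoint_bound.
move=> a y z; apply: ip_injr => x.
by rewrite (ipDr ip) (ipZr ip) -!adjointP// (ipDr ip) (ipZr ip).
Qed.

Lemma adjointK T : B T -> adjoint ip (adjoint ip T) = T.
Proof.
move=> BT; apply: adjoint_uniq; first exact: adjoint_bounded.
by move=> x y; rewrite -(ip_conj ip y) -adjointP// ip_conj.
Qed.

Lemma adjoint_lin a S T : B S -> B T ->
  adjoint ip (a *: S + T) = a^* *: adjoint ip S + adjoint ip T.
Proof.
move=> BS BT; apply: adjoint_uniq; first exact: bounded_lin.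
move=> x y; rewrite !fun_linE (ipDl ip) (ipZl ip) (ipDr ip) (ipZr ip) conjCK.
by rewrite -!adjointP.
Qed.

Lemma adjoint_comp S T : B S -> B T ->
  adjoint ip (S \o T) = adjoint ip T \o adjoint ip S.
Proof.
move=> BS BT; apply: adjoint_uniq; first exact: bounded_comp.
by move=> x y; rewrite /= -!adjointP.
Qed.

Lemma op_norm_adjoint T : B T -> op_norm (adjoint ip T) = op_norm T.
Proof.
move=> BT; have le_adj S : B S -> op_norm (adjoint ip S) <= op_norm S.
  by move=> BS; apply: op_norm_le => [|x]; [exact: op_norm_ge0|exact: adjoint_bound].
apply/eqP; rewrite eq_le le_adj//= -{1}(adjointK BT).
by apply: le_adj; exact: adjoint_bounded.
Qed.

Lemma op_norm_cstar T : B T -> op_norm (adjoint ip T \o T) = op_norm T ^+ 2.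
Proof.
move=> BT; have BA := adjoint_bounded BT.
apply/eqP; rewrite eq_le; apply/andP; split.
  by apply: le_trans (op_norm_comp _ _) _ => //; rewrite op_norm_adjoint.
have BAT : B (adjoint ip T \o T) by exact: bounded_comp.
have N0 := op_norm_ge0 BAT.
rewrite -ler_sqrt// sqrtr_sqr ger0_norm ?op_norm_ge0//.
apply: op_norm_le => [|x]; first exact: sqrtr_ge0.
rewrite -(@ler_pXn2r _ 2)// ?nnegrE ?mulr_ge0 ?nrm_ge0 ?sqrtr_ge0//.
rewrite exprMn sqr_sqrtr//.
(* The reverse inequality is Cauchy-Schwarz applied to [|T x|^2 = <x | T^* T x>]. *)
have -> : nrm (T x) ^+ 2 = nrm (ip x ((adjoint ip T \o T) x)).
  by rewrite /= -adjointP// (ipE hH) nrm_real ger0_norm// sqr_ge0.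
apply: le_trans (CSineq hH _ _) _; rewrite mulrC expr2 mulrA.
by rewrite ler_wpM2r ?nrm_ge0// op_normP.
Qed.

End Operators.

(** * Automatic contractivity of *-representations *)

Section Contractive.
Variables (R : realType) (A : completeNormedModType R[i]).
Variables (mulA : A -> A -> A) (starA : A -> A).
Hypothesis hA : involutive_banach_algebra mulA starA.

Let mulL c x y z : mulA (c *: x + y) z = c *: mulA x z + mulA y z.
Proof. exact: (mul_linl hA). Qed.

Let mul0 x : mulA 0 x = 0.
Proof.
have := mulL 1 0 0 x; rewrite !scale1r addr0 => /esym/(canRL (addrK _)).
by rewrite subrr.
Qed.

Let mulD x y z : mulA (x + y) z = mulA x z + mulA y z.
Proof. by rewrite -[x]scale1r mulL !scale1r. Qed.

Let mulB x y z : mulA (x - y) z = mulA x z - mulA y z.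
Proof. by rewrite addrC -scaleN1r mulL scaleN1r addrC. Qed.

Let mulN x y : nrm (mulA x y) <= nrm x * nrm y.
Proof. exact: (norm_mul hA). Qed.

(** [k] is the Neumann series [h + h^2 + ...], with [d n] the power [h^(n+1)]. Formally [1 + k]
    inverts [1 - h], but [A] may lack a unit, hence the form of the equation. *)
Lemma quasi_inverse (h : A) : nrm h < 1 -> exists k, k = h + mulA k h.
Proof.
move=> h1; pose d n := iter n (mulA^~ h) h.
have dn n : nrm (d n) <= geometric (nrm h) (nrm h) n.
  elim: n => [|n ih]; first by rewrite /= expr0 mulr1.
  by apply: le_trans (mulN _ _) _; rewrite /= exprSr mulrA ler_wpM2r ?nrm_ge0.
have cd : cvgn (series d).
  apply: seq_complete_banach; apply: cauchy_series; apply: series_le_cvg dn _ => [n|n|].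
  - exact: nrm_ge0.
  - by apply: geometric_ge0; exact: nrm_ge0.
  - by apply: is_cvg_geometric_series; rewrite ger0_norm ?nrm_ge0.
set k := limn (series d) in cd; exists k.
have dS n : series d n.+1 = h + mulA (series d n) h.
  elim: n => [|n ih]; first by rewrite seriesEnat /= big_nat1 big_geq// mul0 addr0.
  by rewrite seriesSr [in RHS]seriesSr mulD addrA -ih.
have c1 : (fun n => series d n.+1) @ \oo --> k by rewrite cvg_shiftS.
apply: (cvg_unique (@norm_hausdorff _ A) c1); apply/cvg_nrmP.
have /cvg_nrmP := cd; move=> /cvgM/(_ (cvg_cst (nrm h))); rewrite mul0r.
apply: cvg0_le => n; first exact: nrm_ge0.
by rewrite dS addrAC opprD addrA subrr sub0r addrC -mulB mulN.
Qed.

Variables (H : completeNormedModType R[i]) (ip : {dot H for Num.conj}).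
Hypothesis hH : hilbert_product ip.
Variable pi : A -> H -> H.
Hypothesis hpi : star_representation mulA starA ip pi.

Lemma rep_adjoint a : adjoint ip (pi a) = pi (starA a).
Proof.
apply: (adjoint_uniq hH); first exact: rep_bounded hpi a.
by move=> x y; rewrite -[LHS](ip_conj ip) -(rep_star hpi) ip_conj.
Qed.

Lemma rep_lin c a b x : pi (c *: a + b) x = c *: pi a x + pi b x.
Proof. by rewrite (rep_linear hpi). Qed.

Lemma rep_scale c a x : pi (c *: a) x = c *: pi a x.
Proof.
have p0 : pi 0 x = 0.
  have := rep_lin 1 0 0 x; rewrite !scale1r addr0 => /esym/(canRL (addrK _)).
  by rewrite subrr.
by rewrite -[_ *: a]addr0 rep_lin p0 addr0.
Qed.

(* If [|pi a| = 1 > |a|] then [1 - pi(a^* a)] is inverted by [1 + pi k], where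
   [k] is the sum of the powers of [a^* a]; this bounds [|pi a|] away from 1. *)
Lemma rep_lt1 a : nrm a < 1 -> op_norm (pi a) <= 1 -> op_norm (pi a) < 1.
Proof.
move=> a1 pa1; have Ba := rep_bounded hpi a.
pose h := mulA (starA a) a.
have h1 : nrm h < 1.
  apply: le_lt_trans (mulN _ _) _.
  have -> : nrm (starA a) = nrm a by apply: (@norm_star _ _ hA a I).
  by rewrite mulr_ilt1 ?nrm_ge0.
have [k kE] := quasi_inverse h1.
have Bk := rep_bounded hpi k; have k0 := op_norm_ge0 Bk.
have hE x : pi h x = pi (starA a) (pi a x) by rewrite (rep_mul hpi).
pose c := 1 + op_norm (pi k).
have c1 : 1 <= c by rewrite lerDl.
(* With [y = x - pi h x] one has [x = y + pi k y], so [|x| <= c |y|]; and [|y|^2 = |x|^2 - 2 |pi a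
   x|^2 + |pi h x|^2 <= 2 (|x|^2 - |pi a x|^2)]. Together [|x|^2 <= 2 c^2 (|x|^2 - |pi a x|^2)],
   which explains the constant. *)
have key x : nrm (pi a x) ^+ 2 <= (1 - (2 * c ^+ 2)^-1) * nrm x ^+ 2.
  pose y := x - pi h x.
  have xy : x = y + pi k y.
    rewrite bopB// {1}kE -[h]scale1r rep_lin !scale1r (rep_mul hpi) /=.
    by rewrite addrK subrK.
  have nxy : nrm x <= c * nrm y.
    by rewrite {1}xy mulrDl mul1r; apply: le_trans (nrmD _ _) _;
      rewrite lerD2l op_normP.
  have nh : nrm (pi h x) <= nrm x.
    rewrite hE -rep_adjoint.
    apply: le_trans (op_normP _ (adjoint_bounded hH Ba)) _.
    rewrite (op_norm_adjoint hH)//.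
    have := op_normP x Ba; have := nrm_ge0 x; have := nrm_ge0 (pi a x).
    have := op_norm_ge0 Ba; nra.
  have ny : nrm y ^+ 2 <= 2 * (nrm x ^+ 2 - nrm (pi a x) ^+ 2).
    rewrite /y (nrm_sqrD hH) nrmN.
    have -> : rip ip x (- pi h x) = - nrm (pi a x) ^+ 2.
      rewrite /rip; have -> : ip x (- pi h x) = - ip x (pi h x) by exact: linearNr.
      by rewrite hE -(ip_conj ip) (rep_star hpi) ip_conj (ipE hH).
    have : nrm (pi h x) ^+ 2 <= nrm x ^+ 2 by rewrite lerXn2r// nnegrE nrm_ge0.
    lra.
  have c2 : 0 < 2 * c ^+ 2 by rewrite mulr_gt0// exprn_gt0// (lt_le_trans ltr01).
  rewrite mulrBl mul1r lerBrDr -lerBrDl -ler_pdivlMl ?invr_gt0// invrK.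
  have : nrm x ^+ 2 <= c ^+ 2 * nrm y ^+ 2.
    by rewrite -exprMn lerXn2r// nnegrE ?mulr_ge0 ?nrm_ge0// (le_trans ler01).
  have : 0 <= c ^+ 2 by rewrite sqr_ge0.
  nra.
set q := 1 - _ in key.
have q1 : q < 1.
  by rewrite /q ltrBlDr ltrDl invr_gt0 mulr_gt0// exprn_gt0// (lt_le_trans ltr01).
have q0 : 0 <= q.
  have c2 := exprn_ege1 2 c1.
  by rewrite subr_ge0 invf_le1; lra.
have sq1 : Num.sqrt q < 1 by rewrite -sqrtr1 ltr_sqrt.
apply: le_lt_trans sq1.
apply: op_norm_le => [|x]; first exact: sqrtr_ge0.
  rewrite -(@ler_pXn2r _ 2)// ?nnegrE ?mulr_ge0 ?nrm_ge0 ?sqrtr_ge0//.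
  by rewrite exprMn sqr_sqrtr.
Qed.

(** If [s = |pi a|] exceeded [|a|], then [a / s] would have norm below 1 while its image has norm 1,
    against [rep_lt1]. *)
Lemma rep_contractive a : op_norm (pi a) <= nrm a.
Proof.
rewrite leNgt; apply/negP => lt_a.
set s := op_norm (pi a) in lt_a.
have s0 : 0 < s by apply: le_lt_trans (nrm_ge0 _) lt_a.
have Ba := rep_bounded hpi a.
pose a' := (s^-1)%:C%C *: a.
have sC : nrm ((s^-1)%:C%C : R[i]) = s^-1 by rewrite nrm_real gtr0_norm ?invr_gt0.
have : op_norm (pi a') < 1.
  apply: rep_lt1; first by rewrite nrmZ sC mulrC ltr_pdivrMr ?mul1r.
  apply: op_norm_le => // x; rewrite rep_scale nrmZ sC mulrC ler_pdivrMr// mul1r mulrC.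
  exact: op_normP.
rewrite ltNge => /negP; apply.
rewrite -(ler_pM2l s0) mulr1 {1}/s.
have Ba' := rep_bounded hpi a'.
apply: op_norm_le => [|x]; first by rewrite mulr_ge0 ?op_norm_ge0// ltW.
rewrite -mulrA -ler_pdivrMl// -sC -nrmZ -rep_scale.
exact: op_normP.
Qed.

End Contractive.

(** * The projective tensor product *)

Lemma cvg_sub_infty (k : nat -> nat) : (forall n, (n <= k n)%N) -> k @ \oo --> \oo.
Proof.
move=> kn P [N _ NP]; exists N => // m /= Nm; apply: NP.
exact: leq_trans Nm (kn m).
Qed.

Section Tensor.
Variables (R : realType) (X Y : normedModType R[i]).
Variables (T : completeNormedModType R[i]) (tens : {bilinear X -> Y -> T}).
Hypothesis hT : projective_tensor_product tens.
Local Notation C := R[i].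
Local Notation tsum := (tensor_sum tens).
Implicit Types (s t : seq (X * Y)) (u v : T).

Definition tcost s : R := \sum_(z <- s) nrm z.1 * nrm z.2.

Lemma tcost_ge0 s : 0 <= tcost s.
Proof. by apply: sumr_ge0 => z _; rewrite mulr_ge0 ?nrm_ge0. Qed.

Let tset s := [set tcost t | t in [set t | tsum t = tsum s]].

Let tset_inf s : has_inf (tset s).
Proof.
split; first by exists (tcost s); exists s.
by exists 0 => _ [t _ <-]; exact: tcost_ge0.
Qed.

Lemma tsum_norm s : nrm (tsum s) <= tcost s.
Proof.
rewrite (ptensor_norm hT); apply: ge_inf; first by case: (tset_inf s).
by exists s.
Qed.

Lemma tsum_norm_adherent s e : 0 < e ->
  exists2 t, tsum t = tsum s & tcost t < nrm (tsum s) + e.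
Proof.
move=> e0; rewrite (ptensor_norm hT).
by have [_ [t ts <-] te] := inf_adherent e0 (tset_inf s); exists t.
Qed.

Lemma tens_norm x y : nrm (tens x y) <= nrm x * nrm y.
Proof.
by have := tsum_norm [:: (x, y)]; rewrite /tensor_sum /tcost !big_seq1.
Qed.

Lemma tsum_cat s t : tsum (s ++ t) = tsum s + tsum t.
Proof. by rewrite /tensor_sum big_cat. Qed.

Definition tscale (a : C) s := [seq (a *: z.1, z.2) | z <- s].

Lemma tsum_scale a s : tsum (tscale a s) = a *: tsum s.
Proof.
rewrite /tensor_sum big_map scaler_sumr; apply: eq_bigr => z _ /=.
exact: linearZl_LR.
Qed.

Lemma tsum_dense u : exists s : nat -> seq (X * Y), tsum (s n) @[n --> \oo] --> u.
Proof.
have /choice[s sP] n : exists s, nrm (u - tsum s) < n.+1%:R^-1.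
  by apply: (ptensor_dense hT); rewrite invr_gt0 ltr0n.
exists s; apply/cvg_nrmP; apply: cvg0_le (@cvg_harmonic R) => n; first exact: nrm_ge0.
by rewrite nrmB ltW.
Qed.

Lemma bounded_cvg (f : T -> C^o) (M : R) : linear f ->
  (forall u, nrm (f u) <= M * nrm u) ->

  forall I (F : set_system I) {FF : Filter F} (g : I -> T) l, g @ F --> l -> (f \o g) @
    F --> f l.
Proof.
move=> fl fM I F FF g l /cvg_nrmP gl; apply/cvg_nrmP.
apply: cvg0_leM gl => i; first exact: nrm_ge0.
have -> : (f \o g) i - f l = f (g i - l).
  by rewrite addrC -scaleN1r -fl /= scaleN1r addrC.
exact: fM.
Qed.

Lemma tensor_ext (f g : T -> C^o) : linear f -> continuous f -> linear g -> continuous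
  g ->
  (forall x y, f (tens x y) = g (tens x y)) -> f = g.
Proof.
have lin0 (h : T -> C^o) : linear h -> h 0 = 0.
  move=> /(_ 1 0 0); rewrite !scale1r addr0 => /esym/(canRL (addrK _)).
  by rewrite subrr.
move=> fl fc gl gc fg; apply: funext => u.
have [s su] := tsum_dense u.
have fgs t : f (tsum t) = g (tsum t).
  rewrite /tensor_sum; elim: t => [|z t ih]; first by rewrite !big_nil !lin0.
  by rewrite !big_cons -[tens _ _]scale1r fl gl ih fg.
have := cvg_comp _ _ su (fc u); have := cvg_comp _ _ su (gc u).
have -> : g \o (fun n => tsum (s n)) = f \o (fun n => tsum (s n)).
  by apply: funext => n /=; rewrite fgs.
by move=> h1 h2; apply: (cvg_unique (@norm_hausdorff _ C^o) h2 h1).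
Qed.

Section Lift.
Variables (b : X -> Y -> C) (M : R).
Hypothesis M0 : 0 <= M.
Hypothesis bl : forall a x y z, b (a *: x + y) z = a * b x z + b y z.
Hypothesis br : forall a x y z, b z (a *: x + y) = a * b z x + b z y.
Hypothesis bM : forall x y, nrm (b x y) <= M * nrm x * nrm y.

Let B s : C^o := \sum_(z <- s) b z.1 z.2.

Let B_cat s t : B (s ++ t) = B s + B t.
Proof. by rewrite /B big_cat. Qed.

Let B_scale a s : B (tscale a s) = a *: B s.
Proof.
rewrite /B big_map scaler_sumr; apply: eq_bigr => z _ /=.
have b0 y : b 0 y = 0.
  have := bl 1 0 0 y; rewrite !scale1r mul1r addr0 => /esym/(canRL (addrK _)).
  by rewrite subrr.
by rewrite -[_ *: z.1]addr0 bl b0 addr0.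
Qed.

(** [ptensor_inj] speaks of bundled bilinear forms. The definition is transparent so that [bf]
    unfolds to [b]. *)
Let bf : {bilinear X -> Y -> C^o}.
Proof.
by refine (HB.pack_for {bilinear X -> Y -> C^o} (b : X -> Y -> C^o)
  (bilinear_isBilinear.Build C X Y C^o _ _ _ (conj _ _))) => [z a x y|z a x y].
Defined.

Let B_inj s t : tsum s = tsum t -> B s = B t.
Proof.
move=> st; apply/eqP; rewrite -subr_eq0; apply/eqP.
have -> : B s - B t = B (s ++ tscale (-1) t) by rewrite B_cat B_scale scaleN1r.
apply: (ptensor_inj hT _ bf).
by rewrite tsum_cat tsum_scale st scaleN1r subrr.
Qed.

Let B_norm s : nrm (B s) <= M * nrm (tsum s).
Proof.
apply: ler_mul_eps => // e e0; have [t ts te] := tsum_norm_adherent s e0.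
rewrite -(B_inj ts) /B; apply: le_trans (nrm_sum _ _ _) _.
apply: (@le_trans _ _ (M * tcost t)); last by rewrite ler_wpM2l// ltW.
by rewrite mulr_sumr; apply: ler_sum => z _; rewrite mulrA; exact: bM.
Qed.

Let B_sub s t : nrm (B s - B t) <= M * nrm (tsum s - tsum t).
Proof.
by have := B_norm (s ++ tscale (-1) t); rewrite B_cat B_scale tsum_cat tsum_scale
  !scaleN1r.
Qed.

(** The value [f u] is the limit of [B] along finite sums tending to [u]. It is recorded by the
    estimate [|f u - B s| <= M |u - tsum s|] for every finite sum [s], which makes [B] converge to
    [f u] along every approximating sequence; linearity and the bound follow from this. *)
Lemma tensor_lift_exists : exists f : T -> C^o,
  [/\ linear f, continuous f, forall u, nrm (f u) <= M * nrm u &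
      forall x y, f (tens x y) = b x y].
Proof.
have /choice[f fP] u : exists l : C^o, forall s, nrm (l - B s) <= M * nrm (u - tsum s).
  have [s su] := tsum_dense u.
  have cB : cauchy_seq (fun n => B (s n)).
    move=> e e0; have M1 : 0 < M + 1 by rewrite ltr_wpDl.
    move/cvg_nrmP/cvgrPdist_lt : su => /(_ (e / (M + 1) / 2)) [].
      by rewrite !divr_gt0.
    move=> N _ hN; exists N => m n Nm Nn; apply: le_lt_trans (B_sub _ _) _.
    have := hN _ Nm; have := hN _ Nn => /=.
    rewrite !sub0r !normrN !ger0_norm ?nrm_ge0// => hn hm.
    have : nrm (tsum (s m) - tsum (s n)) < e / (M + 1).
      have := nrmD (tsum (s m) - u) (u - tsum (s n)); rewrite subrKA (nrmB u).
      lra.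
    rewrite ltr_pdivlMr//; have := nrm_ge0 (tsum (s m) - tsum (s n)); nra.
  have [l cl] : exists l : C^o, B (s n) @[n --> \oo] --> l.
    by exists (limn (fun n => B (s n))); exact: seq_complete_complex.
  exists l => t.
  have h1 : nrm (B (s n) - B t) @[n --> \oo] --> nrm (l - B t).
    exact: (cvg_nrm (cvgB cl (cvg_cst _))).
  have h2 : M * nrm (tsum (s n) - tsum t) @[n --> \oo] --> M * nrm (u - tsum t).
    exact: (cvgM (cvg_cst M) (cvg_nrm (cvgB su (cvg_cst _)))).
  by apply: ler_cvg_to h1 h2 _; apply: nearW => n; exact: B_sub.
have fB u (s : nat -> seq (X * Y)) : tsum (s n) @[n --> \oo] --> u -> B (s n) @[n -->
  \oo] --> f u.
  move=> /cvg_nrmP su; apply/cvg_nrmP.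
  apply: (cvg0_leM (M := M)) su => n; first exact: nrm_ge0.
  by have := fP u (s n); rewrite (nrmB u) (nrmB (f u)).
have flin : linear f.
  move=> a u v; have [s su] := tsum_dense u; have [t tv] := tsum_dense v.
  have h1 : tsum (tscale a (s n) ++ t n) @[n --> \oo] --> a *: u + v.
    under eq_fun do rewrite tsum_cat tsum_scale.
    by apply: cvgD => //; apply: cvgZr.
  have := fB _ _ h1; under eq_fun do rewrite B_cat B_scale.
  move=> /(cvg_unique (@norm_hausdorff _ C^o)); apply.
  by apply: cvgD; [apply: cvgZr|]; exact: fB.
have fM u : nrm (f u) <= M * nrm u.
  by have := fP u [::]; rewrite /B /tensor_sum !big_nil !subr0.
exists f; split=> //.
- by move=> u; apply: (bounded_cvg flin fM).
- move=> x y; have := fP (tens x y) [:: (x, y)].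
  rewrite /B /tensor_sum !big_seq1 /= subrr nrm0 mulr0 => h.
  by apply/eqP; rewrite -subr_eq0; apply/eqP/nrm_eq0/le_anti; rewrite h nrm_ge0.
Qed.

Lemma ptensor_liftP :
  [/\ linear (ptensor_lift tens b), forall u, nrm (ptensor_lift tens b u) <= M * nrm u &
      forall x y, ptensor_lift tens b (tens x y) = b x y].
Proof.
have [f [fl fc fM fb]] := tensor_lift_exists.
suff -> : ptensor_lift tens b = f by [].
have : [set g : T -> C^o | [/\ linear g, continuous g & forall x y, g (tens x y) = b x
  y]]
   (ptensor_lift tens b) by apply: (@xgetI _ (fun=> 0) _ f).
move=> [gl gc gb]; apply: tensor_ext => // x y; by rewrite gb fb.
Qed.

End Lift.

Lemma summable_tens (x : nat -> X) (y : nat -> Y) :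
  cvgn (series (fun n => nrm (x n) * nrm (y n))) ->
  exists2 u, series (fun n => tens (x n) (y n)) @ \oo --> u &
    nrm u <= limn (series (fun n => nrm (x n) * nrm (y n))).
Proof.
move=> cxy.
have f0 n : 0 <= nrm (x n) * nrm (y n) by rewrite mulr_ge0 ?nrm_ge0.
have cn : cvgn (series (fun n => nrm (tens (x n) (y n)))).
  by apply: series_le_cvg cxy => n //; [exact: nrm_ge0|exact: tens_norm].
have cu := seq_complete_banach (cauchy_series cn).
exists (limn (series (fun n => tens (x n) (y n)))) => //.
apply: (series_nrm_le cu) => n; apply: le_trans (nneg_series_le n f0 cxy).
by apply: ler_sum => i _; exact: tens_norm.
Qed.

(** Each remainder is approximated by a finite sum whose cost is close to the norm of that
    remainder, and the lists so obtained are concatenated. After the first one the remainders are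
    tiny, so the later lists add little cost. *)
Lemma tensor_series (u : T) (e : R) : 0 < e ->
  exists (x : nat -> X) (y : nat -> Y),
  [/\ cvgn (series (fun n => nrm (x n) * nrm (y n))),
      limn (series (fun n => nrm (x n) * nrm (y n))) <= nrm u + e &
      series (fun n => tens (x n) (y n)) @ \oo --> u].
Proof.
(* The quantity [tcost (L n) + nrm (r n)] grows by at most [3 * d n] per step: [2 * d n] of excess
   cost and [d n] for the new remainder. The factor 1/3 makes the total growth at most [e]. *)
move=> e0; pose d n : R := e / 3 / 2 ^+ n.+1.
have d0 n : 0 < d n by rewrite !divr_gt0// exprn_gt0.
(* Finite approximations of the successive remainders [r n], each starting with
   a zero pair so that the concatenation [L n] has at least [n] terms. *)
have /choice[S SP] (p : nat * T) : exists s, [/\ (0 < size s)%N,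
    nrm (p.2 - tsum s) < d p.1 & tcost s < nrm p.2 + 2 * d p.1].
  have [s sp] := ptensor_dense hT p.2 (d0 p.1).
  have [t ts tc] := tsum_norm_adherent s (d0 p.1).
  exists ((0, 0) :: t); split=> //.
    rewrite /tensor_sum big_cons /= -/(tsum t) ts.
    by have -> : tens 0 0 = 0; [exact: linear0l|rewrite add0r].
  rewrite /tcost big_cons /= nrm0 mul0r add0r -/(tcost t).
  have := nrmD (tsum s - p.2) p.2; rewrite subrK nrmB; lra.
pose r := fix r n := if n is m.+1 then r m - tsum (S (m, r m)) else u.
pose L := fix L n := if n is m.+1 then L m ++ S (m, r m) else [::].
have Ltsum n : tsum (L n) = u - r n.
  elim: n => [|n ih] /=; first by rewrite subrr /tensor_sum big_nil.
  by rewrite tsum_cat ih opprB [RHS]addrA [RHS]addrAC.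
have Lcost n : tcost (L n) + nrm (r n) <= nrm u + e * (1 - (2 ^+ n)^-1).
  elim: n => [|n ih] /=; first by rewrite /tcost big_nil invr1 subrr mulr0 add0r addr0.
  have [_ h1 h2] := SP (n, r n); rewrite /= in h1 h2.
  rewrite /tcost big_cat -!/(tcost _) /=.
  have -> : e * (1 - (2 ^+ n.+1)^-1) = e * (1 - (2 ^+ n)^-1) + 3 * d n.
    by rewrite /d exprS; field; rewrite expf_neq0.
  lra.
have r_d n : nrm (r n.+1) < d n by have [] := SP (n, r n).
have Lsize n : (n <= size (L n))%N.
  elim: n => // n ih /=; rewrite size_cat -addn1 leq_add//.
  by have [] := SP (n, r n).
have Lprefix n m : exists t, L (n + m)%N = L n ++ t.
  elim: m => [|m [t tE]]; first by exists [::]; rewrite addn0 cats0.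
  by exists (t ++ S (n + m, r (n + m))%N); rewrite addnS /= tE catA.
(* Every [L n] is a prefix of the later ones and has at least [n] entries, so the [n]-th entry of
   the infinite concatenation can be read from [L n.+1]. *)
pose z n := nth (0, 0) (L n.+1) n.
have zL n m : (n < size (L m))%N -> nth (0, 0) (L m) n = z n.
  move=> nm; rewrite /z; have nn := Lsize n.+1.
  have /orP[/subnKC h|/subnKC h] := leq_total n.+1 m.
  - by have [t tE] := Lprefix n.+1 (m - n.+1)%N; rewrite -h tE nth_cat nn.
  - by have [t tE] := Lprefix m (n.+1 - m)%N; rewrite -h tE nth_cat nm.
have series_L (V : nmodType) (g : X * Y -> V) m :
    \sum_(0 <= i < size (L m)) g (z i) = \sum_(p <- L m) g p.
  by rewrite (big_nth (0, 0)) !big_nat; apply: eq_bigr => i /zL ->.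
exists (fun n => (z n).1), (fun n => (z n).2).
set f := fun n => nrm (z n).1 * nrm (z n).2.
have f0 n : 0 <= f n by rewrite mulr_ge0 ?nrm_ge0.
have [cf fe] : cvgn (series f) /\ limn (series f) <= nrm u + e.
  apply: nneg_series_cvg => // n.
  apply: (@le_trans _ _ (series f (size (L n)))).
    by apply: nondecreasing_series.
  have -> : series f (size (L n)) = tcost (L n).
    by rewrite seriesEnat; exact: (series_L _ (fun p => nrm p.1 * nrm p.2)).
  have := Lcost n; have := nrm_ge0 (r n).
  have : 0 < (2 ^+ n)^-1 :> R by rewrite invr_gt0 exprn_gt0.
  nra.
split=> //.
(* Absolute summability gives a limit of the whole series; it is identified with [u] along the
   partial sums of lengths [size (L n)]. *)
have [v vz _] := summable_tens cf.
suff -> : u = v by [].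
have h1 := cvg_comp _ _ (cvg_sub_infty Lsize) vz.
apply: (cvg_unique (@norm_hausdorff _ T)) h1.
apply/cvg_nrmP/cvgn0P => [n|e' e'0]; first exact: nrm_ge0.
have [N _ hN] : \forall n \near \oo, d n < e'.
  have : d @ \oo --> (0 : R).
    have -> : d = geometric (e / 3 / 2) 2^-1.
      by apply: funext => n; rewrite /d /= exprS invfM mulrA exprVn.
    by apply: cvg_geometric; rewrite ger0_norm ?invr_ge0// invf_lt1// ltr1n.
  move/cvgrPdist_lt/(_ _ e'0); apply: filterS => n; rewrite sub0r normrN.
  by rewrite gtr0_norm.
exists N.+1 => -[//|n] Nn.
rewrite /comp.
have -> : series (fun n => tens (z n).1 (z n).2) (size (L n.+1)) = u - r n.+1.
  by rewrite -Ltsum seriesEnat; exact: (series_L _ (fun p => tens p.1 p.2)).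
rewrite addrAC subrr sub0r nrmN; apply: lt_trans (r_d n) _.
exact: hN.
Qed.

End Tensor.

(** * The weak* topology of operators *)

Lemma ptws_cvgP (I : Type) (Y : topologicalType) (F : set_system (I -> Y))
    (f : I -> Y) : Filter F ->
  F --> (f : {ptws I -> Y}) <-> forall i, (fun g => g i) @ F --> f i.
Proof.
move=> FF; split=> [Ff i|Ff].
  by move/cvg_sup : Ff => /(_ i) Ff A /= Ai; exact: (Ff _ (@initial_continuous _ _ (@^~
    i) f A Ai)).
apply/cvg_sup => i A /=; rewrite (@nbhsE (initial_topology (@^~ i))).
move=> [_ [[C oC <-] Cfi] CA]; apply: filterS CA _.
exact: (Ff i C (open_nbhs_nbhs (conj oC Cfi))).
Qed.

Lemma initial_cvgP (W : choiceType) (Z : topologicalType) (w : W -> Z)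
    (F : set_system W) (s : W) : Filter F ->
  F --> (s : initial_topology w) <-> w @ F --> w s.
Proof.
move=> FF; split=> [Fs|Fs].
  by move=> A /= As; exact: (Fs _ (@initial_continuous _ _ w s A As)).
move=> A /=; rewrite (@nbhsE (initial_topology w)) => -[_ [[C oC <-] Cs] CA].
by apply: filterS CA _; exact: (Fs C (open_nbhs_nbhs (conj oC Cs))).
Qed.

Lemma cvg_within_eq (X : Type) (Y : topologicalType) (F : set_system X) (D : set X)
    (f g : X -> Y) (l : Y) : Filter F -> (forall x, D x -> f x = g x) ->
  g @ within D F --> l -> f @ within D F --> l.
Proof.
move=> FF fg gl U /gl gU; apply: (@filterS _ F FF _ _ _ gU) => x /= gUx Dx.
by rewrite fg//; exact: gUx.
Qed.

(* In the induction [D] shrinks to the annihilator of the head of the list. *)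
Lemma interpolation (K : fieldType) (E V : lmodType K) (B : E -> V -> K)
    (BlE : forall c a b u, B (c *: a + b) u = c * B a u + B b u)
    (BlV : forall c a u v, B a (c *: u + v) = c * B a u + B a v)
    (us : seq V) :
  forall (D : set E) (g : V -> K), D 0 ->
    (forall c a b, D a -> D b -> D (c *: a + b)) ->
    (forall c u v, g (c *: u + v) = c * g u + g v) ->
    (forall u, (forall a, D a -> B a u = 0) -> g u = 0) ->
  exists2 a, D a & {in us, forall u, B a u = g u}.
Proof.
elim: us => [|u us ih] D g D0 DP gl gD; first by exists 0.
have [[a0 Da0 /eqP Ba0]|/forall2NP nD] := pselect (exists2 a, D a & B a u <> 0);
  last first.
  have uD a : D a -> B a u = 0.
    by move=> Da; apply: contrapT => Bau; case: (nD a).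
  have [a Da ha] := ih D g D0 DP gl gD; exists a => // v;
    rewrite inE => /predU1P[->|/ha//].
  by rewrite uD// gD.
(* Normalized so that [B b0 u = 1]: the multiple [g u *: b0] takes the required value at [u], and
   the rest can be sought among elements annihilating [u]. *)
pose b0 := (B a0 u)^-1 *: a0.
have B0 v : B 0 v = 0.
  by have /esym/(canRL (addrK _)) := BlE 1 0 0 v; rewrite scale1r addr0 mul1r subrr.
have Db0 : D b0 by rewrite -[b0]addr0; exact: DP.
have Bb0 : B b0 u = 1 by rewrite -[b0]addr0 BlE B0 addr0 mulVf.
pose D' := [set a | D a /\ B a u = 0].
(* The correction has to match what [g] still needs once [g u *: b0] has been used. *)
have [||||a [Da Bau] ha] := ih D' (fun v => g v - B b0 v * g u).
- by split.
- by move=> c a b [Da Ba] [Db Bb]; split; [exact: DP|rewrite BlE Ba Bb mulr0 addr0].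
- by move=> c v w; rewrite gl BlV; ring.
- move=> v hv.
  (* For [a] in [D], the element [a - (B a u) b0] lies in [D'] and so annihilates [v]; this says
     that [a] annihilates [v - (B b0 v) u], where [gD] applies. *)
  have : g ((- B b0 v) *: u + v) = 0.
    apply: gD => a Da; have /hv : D' ((- B a u) *: b0 + a).
      by split; [exact: DP|rewrite BlE Bb0 mulr1 addrC subrr].
    by rewrite BlE BlV => h; rewrite -[RHS]h; ring.
  by rewrite gl => h; rewrite -[RHS]h; ring.
- exists (g u *: b0 + a); first exact: DP.
  move=> v; rewrite inE => /predU1P[->|/ha Bav];
    first by rewrite BlE Bb0 Bau mulr1 addr0.
  by rewrite BlE Bav; ring.
Qed.

(** * The pairing of operators with tensors *)

Section Pairing.
Variables (R : realType) (H : completeNormedModType R[i]).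
Variables (ip : {dot H for Num.conj}) (hH : hilbert_product ip).
Variables (T : completeNormedModType R[i]) (tens : {bilinear H -> conjugate H -> T}).
Hypothesis hT : projective_tensor_product tens.
Local Notation C := R[i].
Local Notation B := (@bounded_operators R H).
Implicit Types (S : H -> H) (x y : nat -> H) (u v : T).

Definition tau S : T -> C^o := ptensor_lift tens (fun a (b : conjugate H) => ip (S a)
  b).

Lemma tauP S : B S -> [/\ linear (tau S), forall u, nrm (tau S u) <= op_norm S * nrm u &
  forall a b, tau S (tens a b) = ip (S a) b].
Proof.
move=> BS; apply: (ptensor_liftP hT) => [|c a b d|c a b d|a b].
- exact: op_norm_ge0.
- by rewrite (bopP BS) (ipDl ip) (ipZl ip).
(* A scalar acts on [conjugate H] through its conjugate, which cancels the conjugate-linearity of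
   the inner product. *)
- by rewrite (ipDr ip) (_ : c *: a = (c^* *: (a : H) : H))// (ipZr ip) conjCK.
- apply: le_trans (CSineq hH _ _) _.
  by rewrite ler_wpM2r ?nrm_ge0 ?op_normP//; exact: (nrm_ge0 (b : H)).
Qed.

Lemma tau_norm S u : B S -> nrm (tau S u) <= op_norm S * nrm u.
Proof. by move=> /tauP[]. Qed.

Lemma tau_lin S c u v : B S -> tau S (c *: u + v) = c * tau S u + tau S v.
Proof. by move=> /tauP[/(_ c u v)]. Qed.

Lemma tau_cvg S (z : nat -> T) u : B S -> z @ \oo --> u -> tau S (z n) @[n --> \oo] -->
  tau S u.
Proof. by move=> /tauP[l M _] zu; apply: (bounded_cvg l M zu). Qed.

Lemma tau_sum S x y n : B S ->
  tau S (series (fun n => tens (x n) (y n)) n) = series (fun n => ip (S (x n)) (y n) :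
    C^o) n.
Proof.
move=> BS; have [_ _ tS] := tauP BS.
elim: n => [|n ih].
  rewrite !seriesEnat /= !big_geq//.
  have := tau_lin 1 0 0 BS; rewrite scale1r addr0 mul1r => /esym/(canRL (addrK _)).
  by rewrite subrr.
by rewrite !seriesSr addrC -[tens _ _]scale1r tau_lin// mul1r tS ih addrC.
Qed.

Lemma tau_series S x y u : B S -> series (fun n => tens (x n) (y n)) @ \oo --> u ->
  series (fun n => ip (S (x n)) (y n) : C^o) @ \oo --> tau S u.
Proof.
move=> BS /(tau_cvg BS).
by rewrite (_ : (fun n => _) = series (fun n => ip (S (x n)) (y n) : C^o))//;
  apply: funext => n; exact: tau_sum.
Qed.

Lemma abs_summableP x y : abs_summable x y ->
  exists2 u, series (fun n => tens (x n) (y n)) @ \oo --> u &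
    nrm u <= limn (series (fun n => nrm (x n) * nrm (y n))).
Proof. exact: (summable_tens hT). Qed.

Lemma tensor_summable u (e : R) : 0 < e -> exists x y,
  [/\ abs_summable x y, limn (series (fun n => nrm (x n) * nrm (y n))) <= nrm u + e &
      series (fun n => tens (x n) (y n)) @ \oo --> u].
Proof. exact: (tensor_series hT). Qed.

(** [tau S] is chosen separately for each [S], so linearity in [S] is read off from a series
    representing [u]. *)
Lemma tau_operator_lin S S' c u : B S -> B S' ->
  tau (c *: S + S') u = c * tau S u + tau S' u.
Proof.
move=> BS BS'; have BL := bounded_lin c BS BS'.
have [x [y [_ _ xyu]]] := tensor_summable u ltr01.
have h1 := tau_series BS xyu; have h2 := tau_series BS' xyu.
have h3 := tau_series BL xyu.
apply: (cvg_unique (@norm_hausdorff _ C^o) h3).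
have -> : series (fun n => ip ((c *: S + S') (x n)) (y n) : C^o) =
   (c *: series (fun n => ip (S (x n)) (y n) : C^o)) +
   series (fun n => ip (S' (x n)) (y n) : C^o).
  rewrite -seriesZ -seriesD; congr series; apply: funext => n.
  by rewrite (ipDl ip) (ipZl ip).
exact: (cvgD (cvgZr h1) h2).
Qed.

Let summables := [set z : (nat -> H) * (nat -> H) | abs_summable z.1 z.2].

Lemma trace_pairingE S (z : set_type summables) u : B S ->
  series (fun n => tens ((set_val z).1 n) ((set_val z).2 n)) @ \oo --> u ->
  trace_pairing ip S z = tau S u.
Proof. by move=> BS /(tau_series BS)/(cvg_lim (@norm_hausdorff _ C^o)). Qed.

Lemma operator_weakstar_cvgP (F : set_system (H -> H)) S : Filter F ->
  F --> (S : operator_weakstar ip) <->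
  forall z, trace_pairing ip P z @[P --> F] --> trace_pairing ip S z.
Proof.
move=> FF; split=> h.
- have /ptws_cvgP h' := (initial_cvgP (trace_pairing ip) S FF).1 h.
  by move=> z; apply: h'.
- apply/(initial_cvgP (trace_pairing ip) S FF); apply/ptws_cvgP => z.
  exact: h.
Qed.

Lemma trace_pairing_continuous z :
  continuous ((fun S => trace_pairing ip S z) : operator_weakstar ip -> C^o).
Proof.
move=> S.
by have /operator_weakstar_cvgP := @cvg_id _ (nbhs (S : operator_weakstar ip)); apply.
Qed.

(** Writing [u] as a summable series turns [tau P u], for bounded [P], into one of the functionals
    that define the weak* topology; its zero set is therefore closed. *)
Lemma tau_closure (M : set (H -> H)) S u : M `<=` B -> weakstar_closure ip M S ->
  (forall P, M P -> tau P u = 0) -> tau S u = 0.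
Proof.
move=> MB [BS clS] Mu; have [x [y [xy _ xyu]]] := tensor_summable u ltr01.
pose z : set_type summables := SigSub (mem_set (xy : summables (x, y))).
have tE P : B P -> trace_pairing ip P z = tau P u by move=> BP; exact: trace_pairingE.
rewrite -tE//.
have cl : closed ((fun S => trace_pairing ip S z : C^o) @^-1` [set 0] : set
  (operator_weakstar ip)).
  apply: closed_comp => [P _|]; first exact: trace_pairing_continuous.
  exact: (accessible_closed_set1 (hausdorff_accessible (@norm_hausdorff _ C^o))).
apply: (cl S); apply: closure_subset clS => P MP /=.
by rewrite tE ?Mu//; exact: MB.
Qed.

End Pairing.

(** * Duals of Banach spaces *)

Section Dual.
Variables (R : realType) (V : lmodType R[i]) (S : set V) (N : V -> R).
Hypothesis hS : banach_on S N.
Local Notation C := R[i].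
Implicit Types (mu nu : V -> C^o).

Let N0 x : S x -> 0 <= N x. Proof. exact: banach_on_norm_ge0. Qed.

Lemma dual_lin mu (a : C) x y : dual S N mu -> S x -> S y ->
  mu (a *: x + y) = a * mu x + mu y.
Proof. by case=> _ + _; exact. Qed.

Lemma dual0 mu : dual S N mu -> mu 0 = 0.
Proof.
move=> dmu; have S0 := banach_on0 hS.
have := dual_lin 1 dmu S0 S0; rewrite scale1r addr0 mul1r.
by move=> /esym/(canRL (addrK _)); rewrite subrr.
Qed.

Lemma dualZ mu (a : C) x : dual S N mu -> S x -> mu (a *: x) = a * mu x.
Proof.
move=> dmu Sx; have S0 := banach_on0 hS.
by rewrite -[_ *: _]addr0 dual_lin// dual0// addr0.
Qed.

Lemma dualD mu x y : dual S N mu -> S x -> S y -> mu (x + y) = mu x + mu y.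
Proof. by move=> dmu Sx Sy; rewrite -[x]scale1r dual_lin// mul1r scale1r. Qed.

Lemma dualB mu x y : dual S N mu -> S x -> S y -> mu (x - y) = mu x - mu y.
Proof.
move=> dmu Sx Sy; rewrite addrC -scaleN1r dual_lin//.
by rewrite mulN1r addrC.
Qed.

Lemma dual_norm_ub mu x : dual S N mu -> S x -> nrm (mu x) <= dual_norm S N mu * N x.
Proof.
move=> dmu Sx; have [_ _ [M hM]] := dmu.
apply: (@unit_sup_ub _ _ _ _ (fun x => nrm (mu x)) hS _ M) => // a y Sy.
by rewrite dualZ// nrmM.
Qed.

Lemma dual_norm_ge0 mu : dual S N mu -> 0 <= dual_norm S N mu.
Proof.
move=> dmu; have [_ _ [M hM]] := dmu.
apply: (@unit_sup_ge0 _ _ _ _ (fun x => nrm (mu x)) hS _ M) => // x _.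
exact: nrm_ge0.
Qed.

Lemma dual_norm_le mu M : 0 <= M -> (forall x, S x -> nrm (mu x) <= M * N x) ->
  dual_norm S N mu <= M.
Proof. by move=> M0 hM; exact: (unit_sup_le (g := fun x => nrm (mu x)) hS). Qed.

Lemma dual_comb (c : C) mu nu : dual S N mu -> dual S N nu -> dual S N (c *: mu + nu).
Proof.
move=> dmu dnu; have [omu _ _] := dmu; have [onu _ _] := dnu; split.
- by move=> x /[dup] /omu h1 /onu h2; rewrite !fctE h1 h2 scaler0 addr0.
- move=> a x y Sx Sy; rewrite /= [LHS](_ : _ = c * mu (a *: x + y) + nu (a *: x + y))//.
  rewrite !dual_lin// [RHS](_ : _ = a * (c * mu x + nu x) + (c * mu y + nu y))//.
  by ring.
- exists (nrm c * dual_norm S N mu + dual_norm S N nu) => x Sx.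
  rewrite (_ : (c *: mu + nu) x = c *: mu x + nu x)//.
  apply: le_trans (@nrmD _ C^o _ _) _; rewrite nrmZ mulrDl lerD ?dual_norm_ub//.
  by rewrite -mulrA ler_wpM2l ?dual_norm_ub//; exact: (nrm_ge0 (c : C^o)).
Qed.

Lemma dual_zero : dual S N 0.
Proof.
split=> //; first by move=> a x y _ _; rewrite mulr0 addr0.
by exists 0 => x _; rewrite mul0r (@nrm0 _ C^o).
Qed.

Lemma dual_scale (c : C) mu : dual S N mu -> dual S N (c *: mu).
Proof. by move=> dmu; rewrite -[_ *: _]addr0; apply: dual_comb => //;
  exact: dual_zero. Qed.

Lemma dual_sub mu nu : dual S N mu -> dual S N nu -> dual S N (mu - nu).
Proof. by move=> dmu dnu; rewrite addrC -scaleN1r; exact: dual_comb. Qed.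

Lemma dual_normZ (c : C) mu : dual S N mu ->
  dual_norm S N (c *: mu) = nrm c * dual_norm S N mu.
Proof.
have leZ d nu : dual S N nu -> dual_norm S N (d *: nu) <= nrm d * dual_norm S N nu.
  move=> dnu; have d0 : 0 <= nrm d := nrm_ge0 (d : C^o).
  apply: dual_norm_le => [|x Sx]; first by rewrite mulr_ge0 ?dual_norm_ge0.
  rewrite (_ : (d *: nu) x = d *: nu x)// nrmZ -mulrA ler_wpM2l//.
  exact: dual_norm_ub.
move=> dmu; apply/eqP; rewrite eq_le leZ//=.
have [->|c0] := eqVneq c 0.
  by rewrite /nrm normr0 mul0r; apply: dual_norm_ge0; exact: dual_scale.
have := leZ c^-1 _ (dual_scale c dmu); rewrite scalerA mulVf// scale1r.
have c0' : 0 <= nrm c := nrm_ge0 (c : C^o).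
move=> h; apply: le_trans (ler_wpM2l c0' h) _.
have cc : nrm c * nrm c^-1 = 1 by rewrite -nrmM divff// /nrm normr1.
by rewrite mulrA cc mul1r.
Qed.

(** The limit is taken pointwise, and is 0 outside [S]. Letting [m] tend to infinity in the Cauchy
    estimate bounds [f n - l] uniformly on the unit ball. *)
Lemma dual_complete (f : nat -> V -> C^o) : (forall n, dual S N (f n)) ->
  (forall e, 0 < e -> exists n0, forall m n, (n0 <= m)%N -> (n0 <= n)%N ->
    dual_norm S N (f m - f n) < e) ->
  exists2 l, dual S N l & dual_norm S N (f n - l) @[n --> \oo] --> (0 : R).
Proof.
move=> df cf.
have fx n m x : S x -> nrm (f n x - f m x) <= dual_norm S N (f n - f m) * N x.
  by move=> Sx; apply: (dual_norm_ub (dual_sub (df n) (df m)) Sx).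
have /choice[l hl] x : exists l : C^o, f n x @[n --> \oo] --> l.
  have [Sx|nSx] := pselect (S x); last first.
    exists 0; rewrite (_ : (fun n => f n x) = fun=> 0); first exact: cvg_cst.
    by apply: funext => n; have [-> //] := df n.
  have cfx : cauchy_seq (fun n => f n x).
    move=> e e0; have Nx1 : 0 < N x + 1 by rewrite ltr_wpDl ?N0.
    have [n0 hn0] := cf _ (divr_gt0 e0 Nx1); exists n0 => m n m0 n0'.
    apply: le_lt_trans (fx _ _ _ Sx) _.
    have := hn0 _ _ m0 n0'; rewrite ltr_pdivlMr//.
    have := dual_norm_ge0 (dual_sub (df m) (df n)); have := N0 Sx; nra.
  by exists (limn (fun n => f n x)); exact: seq_complete_complex.
have close e : 0 < e -> exists n0, forall n x, (n0 <= n)%N -> S x ->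
    nrm (f n x - l x) <= e * N x.
  move=> e0; have [n0 hn0] := cf _ e0; exists n0 => n x n0n Sx.
  have h1 : nrm (f n x - f m x) @[m --> \oo] --> nrm (f n x - l x).
    exact: (cvg_nrm (cvgB (cvg_cst _) (hl x))).
  rewrite -(cvg_lim (@Rhausdorff R) h1); apply: limr_le; first by apply: cvgP h1.
  exists n0 => // m /= n0m; apply: le_trans (fx _ _ _ Sx) _.
  by rewrite ler_wpM2r ?N0// ltW// hn0.
have dl : dual S N l.
  split.
  - move=> x nSx; apply: (cvg_unique (@norm_hausdorff _ C^o) (hl x)).
    rewrite (_ : (fun n => f n x) = fun=> 0); first exact: cvg_cst.
    by apply: funext => n; have [-> //] := df n.
  - move=> a x y Sx Sy; apply: (cvg_unique (@norm_hausdorff _ C^o) (hl _)).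
    rewrite (_ : (fun n => _) = fun n => a *: f n x + f n y); last first.
      by apply: funext => n; rewrite dual_lin.
    exact: (cvgD (cvgZr (hl x)) (hl y)).
  - have [n0 hn0] := close 1 ltr01; exists (1 + dual_norm S N (f n0)) => x Sx.
    have := @nrmD _ C^o (l x - f n0 x) (f n0 x); rewrite subrK (nrmB (l x)).
    have := hn0 _ _ (leqnn n0) Sx; have := dual_norm_ub (df n0) Sx.
    rewrite mulrDl; lra.
exists l => //.
have ge0 n : 0 <= dual_norm S N (f n - l) by exact: dual_norm_ge0 (dual_sub (df n) dl).
apply/(cvgn0P ge0) => e e0; have e2 : 0 < e / 2 by rewrite divr_gt0.
have [n0 hn0] := close _ e2; exists n0 => n n0n.
apply: (@le_lt_trans _ _ (e / 2)); last by lra.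
apply: dual_norm_le; [exact: ltW|move=> x Sx; exact: hn0].
Qed.

Lemma dual_banach : banach_on (dual S N) (dual_norm S N).
Proof.
split.
- exact: dual_zero.
- exact: dual_comb.
- move=> mu dmu mu0; apply: funext => x; have [Sx|nSx] := pselect (S x).
    apply: (@nrm_eq0 _ C^o); apply/eqP; rewrite eq_le (nrm_ge0 (mu x)) andbT.
    by have := dual_norm_ub dmu Sx; rewrite mu0 mul0r.
  by have [-> //] := dmu.
- move=> mu nu dmu dnu; apply: dual_norm_le => [|x Sx].
    by rewrite addr_ge0 ?dual_norm_ge0.
  rewrite (_ : (mu + nu) x = mu x + nu x)//; apply: le_trans (@nrmD _ C^o _ _) _.
  by rewrite mulrDl lerD ?dual_norm_ub.
- exact: dual_normZ.
- exact: dual_complete.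
Qed.

End Dual.

Lemma set_bij_can (X Y : Type) (A : set X) (D : set Y) (f : X -> Y) (g : Y -> X) :
  (forall x, A x -> D (f x)) -> (forall y, D y -> A (g y)) ->
  (forall x, A x -> g (f x) = x) -> (forall y, D y -> f (g y) = y) -> set_bij A D f.
Proof.
move=> fAD gDA gf fg; split=> //.
  by move=> x y /set_mem Ax /set_mem Ay fxy; rewrite -(gf x)// fxy gf.
by move=> y Dy; exists (g y); [exact: gDA|exact: fg].
Qed.

(** * The Fourier space and the von Neumann algebra *)

Section FourierSpace.
Variables (R : realType) (A H : completeNormedModType R[i]).
Variables (mulA : A -> A -> A) (starA : A -> A).
Hypothesis hA : involutive_banach_algebra mulA starA.
Variables (ip : {dot H for Num.conj}) (hH : hilbert_product ip).
Variables (pi : A -> H -> H) (hpi : star_representation mulA starA ip pi).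
Variables (T : completeNormedModType R[i]) (tens : {bilinear H -> conjugate H -> T}).
Hypothesis hT : projective_tensor_product tens.
Local Notation C := R[i].
Local Notation B := (@bounded_operators R H).
Local Notation F := (fourier_space ip pi tens).
Local Notation normF := (fourier_norm ip pi tens).
Local Notation fmap := (fourier_map ip pi tens).
Local Notation coef := (coef ip pi).
Local Notation is_coef_sum := (is_coef_sum ip pi).
Implicit Types (S : H -> H) (x y : nat -> H) (u v : T) (phi psi : A -> C^o).
Local Notation total x y := (limn (series (fun n => nrm (x n) * nrm (y n)))).

Let Bpi a : B (pi a). Proof. exact: rep_bounded hpi a. Qed.

Lemma fourier_mapE u a : fmap u a = tau ip tens (pi a) u.
Proof. by []. Qed.

Lemma fourier_map_lin c u v : fmap (c *: u + v) = c *: fmap u + fmap v.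
Proof.
by apply: funext => a; rewrite fourier_mapE (tau_lin hH hT).
Qed.

Lemma fourier_map_in u : F (fmap u).
Proof. by exists u. Qed.

Lemma fourier_map0 : fmap 0 = 0.
Proof.
have := fourier_map_lin 1 0 0; rewrite !scale1r addr0 => /esym/(canRL (addrK _)).
by rewrite subrr.
Qed.

Lemma fourier_mapB u v : fmap (u - v) = fmap u - fmap v.
Proof. by rewrite addrC -scaleN1r fourier_map_lin scaleN1r addrC. Qed.

Lemma fourier_mapD u v : fmap (u + v) = fmap u + fmap v.
Proof. by rewrite -[u]scale1r fourier_map_lin !scale1r. Qed.

Lemma fourier_mapZ c u : fmap (c *: u) = c *: fmap u.
Proof. by rewrite -[c *: u]addr0 fourier_map_lin fourier_map0 addr0. Qed.

Lemma fourier_map_tens a b : fmap (tens a b) = coef a b.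
Proof.
by apply: funext => c; rewrite fourier_mapE; have [_ _ ->] := tauP hH hT (Bpi c).
Qed.

Lemma fourier_map_sum x y u : series (fun n => tens (x n) (y n)) @ \oo --> u ->
  is_coef_sum x y (fmap u).
Proof. by move=> xyu a; exact: tau_series (Bpi a) xyu. Qed.

Lemma is_coef_sum_uniq x y phi psi : is_coef_sum x y phi -> is_coef_sum x y psi ->
  phi = psi.
Proof.
move=> xp xq; apply: funext => a.
exact: (cvg_unique (@norm_hausdorff _ C^o) (xp a) (xq a)).
Qed.

(** Absolute summability makes the tensor series converge in norm, and pointwise limits are unique;
    so a pointwise sum is always the image of a norm-convergent series. This is why
    [sigma(A^*, A)]-convergence yields convergence in the quotient norm. *)
Lemma is_coef_sum_fourier x y phi : abs_summable x y -> is_coef_sum x y phi ->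
  exists u, [/\ fmap u = phi, series (fun n => tens (x n) (y n)) @ \oo --> u &
    nrm u <= total x y].
Proof.
move=> xy xyphi; have [u xyu nu] := abs_summableP hT xy.
by exists u; split=> //; apply: is_coef_sum_uniq xyphi; exact: fourier_map_sum.
Qed.

Let Nset phi := [set nrm z | z in [set z | fmap z = phi]].

Let Nset_lb phi : has_lbound (Nset phi).
Proof. by exists 0 => _ [z _ <-]; exact: nrm_ge0. Qed.

Lemma fourier_norm_le u : normF (fmap u) <= nrm u.
Proof. by apply: (ge_inf (Nset_lb _)); exists u. Qed.

Lemma fourier_norm_adherent phi e : F phi -> 0 < e ->
  exists2 u, fmap u = phi & nrm u < normF phi + e.
Proof.
move=> [u _ uphi] e0.
have h : has_inf (Nset phi) by split=> //; exists (nrm u); exists u.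
by have [_ [v vphi <-] ve] := inf_adherent e0 h; exists v.
Qed.

Lemma fourier_norm_ge0 phi : F phi -> 0 <= normF phi.
Proof.
move=> [u _ uphi]; apply: lb_le_inf; first by exists (nrm u); exists u.
by move=> _ [z _ <-]; exact: nrm_ge0.
Qed.

Lemma fourier_norm_le_total x y phi : abs_summable x y -> is_coef_sum x y phi ->
  F phi /\ normF phi <= total x y.
Proof.
move=> xy xyphi; have [u [<- _ nu]] := is_coef_sum_fourier xy xyphi.
by split; [exists u|apply: le_trans nu; exact: fourier_norm_le].
Qed.

Lemma fourier_rep phi e : F phi -> 0 < e -> exists x y,
  [/\ abs_summable x y, is_coef_sum x y phi & total x y <= normF phi + e].
Proof.
move=> Fphi e0; have e2 : 0 < e / 2 by rewrite divr_gt0.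
have [u <- ue] := fourier_norm_adherent Fphi e2.
have [x [y [xy xye xyu]]] := tensor_summable hT u e2.
exists x, y; split=> //; first exact: fourier_map_sum.
by move: xye ue; rewrite /fourier_norm; lra.
Qed.

Lemma fourier_series_cvg x y phi : abs_summable x y -> is_coef_sum x y phi ->
  normF (series (fun n => coef (x n) (y n)) n - phi) @[n --> \oo] --> (0 : R) /\
  forall n, F (series (fun n => coef (x n) (y n)) n).
Proof.
move=> xy xyphi; have [u [<- xyu _]] := is_coef_sum_fourier xy xyphi.
have sE n : series (fun n => coef (x n) (y n)) n = fmap (series (fun n => tens (x n) (y
  n)) n).
  elim: n => [|n ih]; first by rewrite !seriesEnat /= !big_geq// fourier_map0.
  by rewrite !seriesSr fourier_mapD ih fourier_map_tens.
split=> [|n]; last by rewrite sE; exact: fourier_map_in.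
move/cvg_nrmP : xyu; apply: cvg0_le => n; rewrite sE -fourier_mapB.
  by apply: fourier_norm_ge0; exact: fourier_map_in.
exact: fourier_norm_le.
Qed.

Lemma fourier_bound phi a : F phi -> nrm (phi a) <= nrm a * normF phi.
Proof.
move=> Fphi; apply: ler_mul_eps => [|e e0]; first exact: nrm_ge0.
have [u <- ue] := fourier_norm_adherent Fphi e0.
apply: le_trans (tau_norm hH hT _ (Bpi a)) _.
apply: ler_pM; [exact: op_norm_ge0|exact: nrm_ge0| |exact: ltW].
exact: (rep_contractive hA hH hpi).
Qed.

Lemma fourier_normD phi psi : F phi -> F psi -> normF (phi + psi) <= normF phi + normF
  psi.
Proof.
move=> Fp Fq; apply/ler_addgt0Pr => e e0; have e2 : 0 < e / 2 by rewrite divr_gt0.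
have [u pu ue] := fourier_norm_adherent Fp e2.
have [v qv ve] := fourier_norm_adherent Fq e2.
rewrite -{1}pu -{1}qv -fourier_mapD; apply: le_trans (fourier_norm_le _) _.
apply: le_trans (nrmD _ _) _; lra.
Qed.

Lemma fourier_normZ c phi : F phi -> normF (c *: phi) = nrm c * normF phi.
Proof.
have leZ d psi : F psi -> normF (d *: psi) <= nrm d * normF psi.
  have d0 : 0 <= nrm d := nrm_ge0 (d : C^o).
  move=> Fp; apply: ler_mul_eps => // e e0.
  have [u pu ue] := fourier_norm_adherent Fp e0.
  rewrite -{1}pu -fourier_mapZ; apply: le_trans (fourier_norm_le _) _.
  by rewrite nrmZ ler_wpM2l// ltW.
move=> Fp; apply/eqP; rewrite eq_le leZ//=.
have [->|c0] := eqVneq c 0.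
  rewrite /nrm normr0 mul0r; apply: fourier_norm_ge0.
  by exists 0 => //; rewrite scale0r fourier_map0.
have c0' : 0 < nrm c.
  rewrite lt_neqAle (nrm_ge0 (c : C^o)) andbT eq_sym.
  by apply: contra_neq c0; exact: (@nrm_eq0 _ C^o).
have Fc : F (c *: phi) by case: Fp => u _ <-; exists (c *: u) => //;
  exact: fourier_mapZ.
have := leZ c^-1 _ Fc; rewrite scalerA mulVf// scale1r.
have cc : nrm c^-1 * nrm c = 1 by rewrite -nrmM mulVf// /nrm normr1.
have : 0 <= normF (c *: phi) by exact: fourier_norm_ge0.
move=> h1 h2; have : nrm c * normF phi <= nrm c * (nrm c^-1 * normF (c *: phi)).
  by rewrite ler_wpM2l// ltW.
by rewrite mulrA [X in _ <= X * _]mulrC cc mul1r.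
Qed.

(** As for any quotient norm: the increments of a subsequence, of norm less than [2^-k], lift to
    tensors of norm less than [2^-k], whose series converges because the tensor product is
    complete. *)
Lemma fourier_complete (f : nat -> A -> C^o) : (forall n, F (f n)) ->
  (forall e, 0 < e ->
    exists n0, forall m n, (n0 <= m)%N -> (n0 <= n)%N -> normF (f m - f n) < e) ->
  exists2 l, F l & normF (f n - l) @[n --> \oo] --> (0 : R).
Proof.
move=> Ff cf.
have FB phi psi : F phi -> F psi -> F (phi - psi).
  by move=> [u _ <-] [v _ <-]; exists (u - v) => //; exact: fourier_mapB.
pose d k : R := 1 / 2 ^+ k.
have d0 k : 0 < d k by rewrite divr_gt0// exprn_gt0.
have /choice[N hN] k : exists n0, (k <= n0)%N /\ forall m n, (n0 <= m)%N -> (n0 <= n)%N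
  ->
    normF (f m - f n) < d k.
  have [n0 hn0] := cf _ (d0 k); exists (maxn n0 k); split; first exact: leq_maxr.
  move=> m n; rewrite !geq_max => /andP[m0 _] /andP[n0' _]; exact: hn0.
(* The maximum makes [p] nondecreasing, so that [p k] and [p k.+1] both lie beyond [N k]. *)
pose p := fix p k := if k is j.+1 then maxn (N k) (p j) else N 0%N.
have Np k : (N k <= p k)%N by case: k => [|k] //=; exact: leq_maxl.
have fp k : normF (f (p k.+1) - f (p k)) < d k.
  by apply: (hN k).2 => //; apply: leq_trans (Np k) _; exact: leq_maxr.
have /choice[w hw] k : exists u, fmap u = f (p k.+1) - f (p k) /\ nrm u < d k.
  have dk : 0 < d k - normF (f (p k.+1) - f (p k)) by rewrite subr_gt0.
  have [u uf un] := fourier_norm_adherent (FB _ _ (Ff (p k.+1)) (Ff (p k))) dk.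
  by exists u; split=> //; move: un; lra.
have [w0 _ fw0] := Ff (p 0%N).
have cw : cvgn (series (fun k => nrm (w k))).
  apply: (@series_le_cvg _ _ d) => [k|k|k|]; [exact: nrm_ge0|exact: ltW| |].
    by case: (hw k) => _ /ltW.
  have -> : d = geometric 1 2^-1 by apply: funext => k; rewrite /d /= exprVn.
  by apply: is_cvg_geometric_series; rewrite ger0_norm ?invr_ge0// invf_lt1// ltr1n.
have [s ws] : exists s : T, series w @ \oo --> s.
  by exists (limn (series w)); exact: (seq_complete_banach (cauchy_series cw)).
have fpE k : f (p k) = fmap (w0 + series w k).
  elim: k => [|k ih]; first by rewrite seriesEnat /= big_geq// addr0 fw0.
  rewrite seriesSr addrA fourier_mapD -ih; case: (hw k) => -> _.
  by rewrite addrC subrK.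
exists (fmap (w0 + s)); first exact: fourier_map_in.
have ge0 n : 0 <= normF (f n - fmap (w0 + s)).
  by apply: fourier_norm_ge0; apply: FB => //; exact: fourier_map_in.
apply/(cvgn0P ge0) => e e0.
have e2 : 0 < e / 2 by rewrite divr_gt0.
have [n0 hn0] := cf _ e2.
have := (cvgn0P (fun n => nrm_ge0 (series w n - s))).1 ((cvg_nrmP _ _).1 ws) _ e2.
move=> [k0 hk0].
pose k := maxn n0 k0.
have /andP[n0k k0k] : (n0 <= k)%N && (k0 <= k)%N by rewrite leq_maxl leq_maxr.
exists n0 => n n0n.
have -> : f n - fmap (w0 + s) = (f n - f (p k)) + fmap (series w k - s).
  have -> : fmap (series w k - s) = f (p k) - fmap (w0 + s).
    by rewrite fpE -fourier_mapB opprD addrACA subrr add0r.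
  by rewrite addrA subrK.
apply: le_lt_trans (fourier_normD _ _) _; [exact: FB|exact: fourier_map_in|].
have h1 : normF (f n - f (p k)) < e / 2.
  apply: hn0 => //; apply: leq_trans n0k _; apply: leq_trans (Np k); exact: (hN k).1.
have h2 := hk0 k k0k; have h3 := fourier_norm_le (series w k - s).
lra.
Qed.

Lemma fourier_banach : banach_on F normF.
Proof.
split.
- by exists 0 => //; exact: fourier_map0.
- move=> c _ _ [u _ <-] [v _ <-]; exists (c *: u + v) => //; exact: fourier_map_lin.
- move=> phi Fphi phi0; apply: funext => a; apply: (@nrm_eq0 _ C^o).
  apply/eqP; rewrite eq_le (nrm_ge0 (phi a)) andbT.
  by have := fourier_bound a Fphi; rewrite phi0 mulr0.
- exact: fourier_normD.
- exact: fourier_normZ.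
- exact: fourier_complete.
Qed.

(** * Operators acting on summable pairs, and the weak* closure of the range of [pi] *)

Lemma abs_summableC x y : abs_summable x y -> abs_summable y x /\ total y x = total x y.
Proof.
rewrite /abs_summable; have -> // : (fun n => nrm (x n) * nrm (y n)) = (fun n => nrm (y
  n) * nrm (x n)).
by apply: funext => n; rewrite mulrC.
Qed.

Lemma abs_summable_compl S x y : B S -> abs_summable x y ->
  abs_summable (S \o x) y /\ total (S \o x) y <= op_norm S * total x y.
Proof.
move=> BS xy; apply: nneg_series_cvg => n; first by rewrite mulr_ge0 ?nrm_ge0.
apply: (@le_trans _ _ (op_norm S * series (fun n => nrm (x n) * nrm (y n)) n)).
  rewrite !seriesEnat /= mulr_sumr; apply: ler_sum => i _.
  by rewrite mulrA ler_wpM2r ?nrm_ge0 ?op_normP.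
rewrite ler_wpM2l ?op_norm_ge0//; apply: nneg_series_le => // i.
by rewrite mulr_ge0 ?nrm_ge0.
Qed.

Lemma abs_summable_compr S x y : B S -> abs_summable x y ->
  abs_summable x (S \o y) /\ total x (S \o y) <= op_norm S * total x y.
Proof.
move=> BS xy; have [yx <-] := abs_summableC xy.
have [h1 h2] := abs_summable_compl BS yx.
by have [h3 ->] := abs_summableC h1.
Qed.

Let summables := [set z : (nat -> H) * (nat -> H) | abs_summable z.1 z.2].

Lemma VN_bounded S : VN ip pi S -> B S.
Proof. by case. Qed.

Lemma VN_tau S : VN ip pi S <-> B S /\ forall u, fmap u = 0 -> tau ip tens S u = 0.
Proof.
split=> [vS|[BS Su]].
  split=> [|u u0]; first by case: vS.
  apply: (tau_closure hH hT _ vS) => [_ [a _ <-] //|_ [a _ <-]].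
  by rewrite -fourier_mapE u0.
split=> //; rewrite closureEcvg.
have /choice[U hU] (z : set_type summables) : exists u,
    series (fun n => tens ((set_val z).1 n) ((set_val z).2 n)) @ \oo --> u.
  have [u zu _] := abs_summableP hT (set_valP z); by exists u.
have tpE P z : B P -> trace_pairing ip P z = tau ip tens P (U z).
  by move=> BP; exact: (trace_pairingE hH hT).
(* The operators [pi a] that agree with [S] on the finitely many pairs in [l]. These sets are
   nonempty by [interpolation] and generate a filter on the range of [pi] that tends to [S]. *)
pose E (l : seq (set_type summables)) := [set P | exists2 a, P = pi a &
  {in l, forall z, trace_pairing ip P z = trace_pairing ip S z}].
have EF : ProperFilter (filter_from [set: seq (set_type summables)] E).
  apply: filter_from_proper; first apply: filter_from_filter; first by exists [::].
  - move=> l m _ _; exists (l ++ m) => // P [a Pa Plm].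
    by split; exists a => // z zl; apply: Plm; rewrite mem_cat zl ?orbT.
  - move=> l _.
    (* The last condition of [interpolation] asks that [tau S] vanish on each tensor annihilated by
       all [tau (pi a)], which is the hypothesis [Su]. *)
    have [|||||u hu|a _ ha] := @interpolation C A T (fun a u => tau ip tens (pi a) u)
        _ _ [seq U z | z <- l] setT (tau ip tens S).
    + move=> c a b u /=; rewrite (rep_linear hpi); exact: (tau_operator_lin hH hT).
    + by move=> c a u v /=; exact: (tau_lin hH hT).
    + by [].
    + by [].
    + by move=> c u v; exact: (tau_lin hH hT).
    + by apply: Su; apply: funext => a; rewrite fourier_mapE hu.
    + by exists (pi a), a => // z zl; rewrite !tpE// ha// map_f.
exists (filter_from [set: seq (set_type summables)] E) => //.
split; last by move=> P hP; exists [::] => // _ [a -> _]; apply: hP; exists a.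
apply/(operator_weakstar_cvgP ip S (filter_filter (F := _))) => z A0 /nbhs_singleton
  A0S.
by exists [:: z] => // P [a _ Pz] /=; rewrite Pz ?inE.
Qed.

(** The same criterion stated with sequences: operators can then be moved termwise across the inner
    product. *)
Lemma VN_series S : VN ip pi S <-> B S /\ forall x y, abs_summable x y ->
  is_coef_sum x y 0 -> series (fun n => ip (S (x n)) (y n) : C^o) @ \oo --> (0 : C^o).
Proof.
split=> [/VN_tau[BS Su]|[BS Su]]; [split=> // x y xy xy0|apply/VN_tau; split=> // u u0].
- have [u [u0 xyu _]] := is_coef_sum_fourier xy xy0.
  by rewrite -(Su u u0); exact: (tau_series hH hT).
- have [x [y [xy _ xyu]]] := tensor_summable hT u ltr01.
  apply: (cvg_unique (@norm_hausdorff _ C^o) (tau_series hH hT BS xyu)).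
  by apply: Su => //; rewrite -u0; exact: fourier_map_sum.
Qed.

Lemma VN_pi a : VN ip pi (pi a).
Proof. by apply/VN_series; split=> // x y xy; exact. Qed.

Lemma VN_comp S S' : VN ip pi S -> VN ip pi S' -> VN ip pi (S \o S').
Proof.
move=> /VN_series[BS hS] /VN_series[BS' hS']; apply/VN_series.
split=> [|x y xy xy0]; first exact: bounded_comp.
have [S'xy _] := abs_summable_compl BS' xy.
apply: (hS (S' \o x)) => // a.
have [xay _] := abs_summable_compr (Bpi (starA a)) xy.
have aE z w : ip (pi a z) w = ip z (pi (starA a) w).
  by rewrite -[LHS](ip_conj ip) -(rep_star hpi) ip_conj.
rewrite (_ : (fun n => _) = fun n => ip (S' (x n)) ((pi (starA a) \o y) n)).
  apply: hS' => // b; rewrite (_ : (fun n => _) = fun n => coef (x n) (y n) (mulA a b)).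
    exact: xy0.
  by apply: funext => n; rewrite /Defs.coef -aE (rep_mul hpi).
by apply: funext => n; rewrite /Defs.coef aE.
Qed.

Lemma cvg_conj (f : nat -> C^o) (l : C^o) : f @ \oo --> l ->
  (fun n => (f n)^* : C^o) @ \oo --> (l^* : C^o).
Proof.
move=> /cvg_nrmP fl; apply/cvg_nrmP; apply: cvg0_le fl => n; first exact: nrm_ge0.
by rewrite -rmorphB nrm_conj.
Qed.

Lemma series_conj (f : nat -> C^o) (l : C^o) : series f @ \oo --> l ->
  series (fun n => (f n)^* : C^o) @ \oo --> (l^* : C^o).
Proof.
move=> /cvg_conj; rewrite (_ : (fun n => _) = series (fun n => (f n)^* : C^o))//.
by apply: funext => n; rewrite !seriesEnat /= rmorph_sum.
Qed.

Lemma is_coef_sum_star x y phi : is_coef_sum x y phi ->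
  is_coef_sum y x (func_star starA phi).
Proof.
move=> xyphi a; have := series_conj (xyphi (starA a)).
rewrite (_ : (fun n => _) = fun n => coef (y n) (x n) a)//.
by apply: funext => n; rewrite /Defs.coef (rep_star hpi) ip_conj.
Qed.

(** Exchanging [x] and [y] replaces the sum [phi] by [phi^*], so pairs with coefficient sum 0 are
    preserved, and the series for the adjoint is the conjugate of the exchanged one. *)
Lemma VN_adjoint S : VN ip pi S -> VN ip pi (adjoint ip S).
Proof.
move=> /VN_series[BS hS]; apply/VN_series; split=> [|x y xy xy0].
  exact: adjoint_bounded.
have [yx _] := abs_summableC xy.
have yx0 : is_coef_sum y x 0.
  have := is_coef_sum_star xy0; congr (is_coef_sum _ _ _).
  by apply: funext => a; rewrite /func_star /= conjC0.
have := series_conj (hS _ _ yx yx0); rewrite conjC0.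
rewrite (_ : (fun n => _) = fun n => ip (adjoint ip S (x n)) (y n))//.
by apply: funext => n; rewrite (adjointP hH BS) ip_conj.
Qed.

Lemma VN_lin c S S' : VN ip pi S -> VN ip pi S' -> VN ip pi (c *: S + S').
Proof.
move=> /VN_tau[BS hS] /VN_tau[BS' hS']; apply/VN_tau; split; first exact: bounded_lin.
by move=> u u0; rewrite (tau_operator_lin hH hT)// hS// hS'// mulr0 addr0.
Qed.

Lemma VN_zero : VN ip pi 0.
Proof.
apply/VN_series; split; first exact: bounded0.
move=> x y _ _; rewrite (_ : series _ = fun=> 0); first exact: cvg_cst.
by apply: funext => n; rewrite seriesEnat /= big1// => i _; rewrite (ip0l ip).
Qed.

Lemma VN_von_neumann : von_neumann_subalgebra ip (VN ip pi).
Proof.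
split.
- by move=> S /VN_bounded.
- exact: VN_zero.
- exact: VN_lin.
- exact: VN_comp.
- exact: VN_adjoint.
- move=> S clS; apply/VN_tau; split=> [|u u0]; first by case: clS.
  apply: (tau_closure hH hT _ clS) => [P /VN_bounded//|P /VN_tau[_]]; exact.
Qed.

Lemma VN_min (M : set (H -> H)) : von_neumann_subalgebra ip M -> range pi `<=` M ->
  VN ip pi `<=` M.
Proof.
move=> hM piM S [BS clS]; apply: (vn_closed hM); split=> //.
by apply: closure_subset clS.
Qed.

(** * Module action and involution on the Fourier space *)

Local Notation dualF := (dual F normF).
Local Notation VN := (VN ip pi).
Implicit Types (mu nu : (A -> C^o) -> C^o).

Let hF : banach_on F normF := fourier_banach.

Let starK a : starA (starA a) = a.
Proof. exact: (@star_star _ _ hA a I). Qed.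

Let pi_star a z w : ip (pi a z) w = ip z (pi (starA a) w).
Proof. by rewrite -[LHS](ip_conj ip) -(rep_star hpi) ip_conj. Qed.

Let op_norm_star a : op_norm (pi (starA a)) <= nrm a.
Proof.
apply: le_trans (rep_contractive hA hH hpi _) _.
by rewrite (_ : nrm (starA a) = nrm a)//; apply: (@norm_star _ _ hA a I).
Qed.

Lemma right_act_coef_sum x y phi a : is_coef_sum x y phi ->
  is_coef_sum x (pi (starA a) \o y) (right_act mulA phi a).
Proof.
move=> xyphi b; rewrite (_ : (fun n => _) = fun n => coef (x n) (y n) (mulA a b)).
  exact: xyphi.
by apply: funext => n; rewrite /Defs.coef /= -pi_star (rep_mul hpi).
Qed.

Lemma fourier_right_act phi a : F phi ->
  F (right_act mulA phi a) /\ normF (right_act mulA phi a) <= normF phi * nrm a.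
Proof.
move=> Fphi.
have key e : 0 < e -> F (right_act mulA phi a) /\
    normF (right_act mulA phi a) <= nrm a * (normF phi + e).
  move=> e0; have [x [y [xy xyphi xye]]] := fourier_rep Fphi e0.
  have [xy' xye'] := abs_summable_compr (Bpi (starA a)) xy.
  have [? h] := fourier_norm_le_total xy' (@right_act_coef_sum _ _ _ a xyphi).
  split=> //; apply: le_trans h _; apply: le_trans xye' _.
  have t0 : 0 <= total x y.
    by apply: le_trans (nneg_series_le 0 _ xy); [rewrite seriesEnat /= big_geq|
      move=> n; rewrite mulr_ge0 ?nrm_ge0].
  by apply: ler_pM => //; [exact: op_norm_ge0].
split; first by case: (key _ ltr01).
rewrite mulrC; apply: ler_mul_eps; first exact: nrm_ge0.
by move=> e /key[].
Qed.

Lemma func_starK phi : func_star starA (func_star starA phi) = phi.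
Proof. by apply: funext => a; rewrite /func_star starK conjCK. Qed.

Lemma func_star_coef xi eta : func_star starA (coef xi eta) = coef eta xi.
Proof. by apply: funext => a; rewrite /func_star /Defs.coef (rep_star hpi) ip_conj. Qed.

Lemma func_star_lin c phi psi : func_star starA (c *: phi + psi) =
  c^* *: func_star starA phi + func_star starA psi.
Proof.
by apply: funext => a; rewrite /func_star [X in X^*](_ : _ = c * phi (starA a) + psi
  (starA a))//
  rmorphD rmorphM.
Qed.

Lemma fourier_func_star phi : F phi -> F (func_star starA phi) /\
  normF (func_star starA phi) = normF phi.
Proof.
have key psi : F psi -> F (func_star starA psi) /\ normF (func_star starA psi) <= normF
  psi.
  move=> Fpsi; have key e : 0 < e -> F (func_star starA psi) /\
      normF (func_star starA psi) <= normF psi + e.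
    move=> e0; have [x [y [xy xypsi xye]]] := fourier_rep Fpsi e0.
    have [yx tot] := abs_summableC xy.
    have [? h] := fourier_norm_le_total yx (is_coef_sum_star xypsi).
    by split=> //; apply: le_trans h _; rewrite tot.
  split; first by case: (key _ ltr01).
  by apply/ler_addgt0Pr => e /key[].
move=> Fphi; have [Fs Ns] := key _ Fphi; split=> //.
apply/eqP; rewrite eq_le Ns /=.
by have [_] := key _ Fs; rewrite func_starK.
Qed.

Lemma Adual_func_star phi : Adual phi -> Adual (func_star starA phi) /\
  Adual_norm (func_star starA phi) = Adual_norm phi.
Proof.
have bA := banach_on_setT A.
have star_nrm a : nrm (starA a) = nrm a by apply: (@norm_star _ _ hA a I).
have key psi : Adual psi -> Adual (func_star starA psi).
  move=> dpsi; have [_ lpsi [M psiM]] := dpsi; split.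
  - by move=> x; case.
  - move=> c a b _ _; rewrite /func_star (_ : starA _ = c^* *: starA a + starA b).
      by rewrite lpsi// rmorphD rmorphM /= conjCK.
    exact: (@star_conjlin _ _ hA c a b I I).
  - exists M => a _; rewrite /func_star [nrm _](_ : _ = nrm (psi (starA a)));
      last exact: nrm_conj.
    by have := psiM (starA a) I; rewrite /nrmA star_nrm.
have key_le psi : Adual psi -> Adual_norm (func_star starA psi) <= Adual_norm psi.
  move=> dpsi; apply: (dual_norm_le bA) => [|a _]; first exact: (dual_norm_ge0 bA dpsi).
  rewrite /func_star [nrm _](_ : _ = nrm (psi (starA a))); last exact: nrm_conj.
  by have := dual_norm_ub bA dpsi (I : [set: A] (starA a)); rewrite star_nrm.
move=> dphi; split; first exact: key.
apply/eqP; rewrite eq_le key_le//=.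
by have := key_le _ (key _ dphi); rewrite func_starK.
Qed.

Lemma fourier_Adual phi : F phi -> Adual phi /\ Adual_norm phi <= normF phi.
Proof.
move=> Fphi; have bd a : nrm (phi a) <= normF phi * nrm a.
  by rewrite mulrC; exact: fourier_bound.
have p0 := fourier_norm_ge0 Fphi.
split; last by apply: (dual_norm_le (banach_on_setT A)) => // a _; exact: bd.
split; [by move=> x; case| |by exists (normF phi) => a _; exact: bd].
move=> c a b _ _; have [u _ <-] := Fphi.
by rewrite !fourier_mapE (rep_linear hpi) (tau_operator_lin hH hT).
Qed.

(** * Functionals on the Fourier space and the operators representing them *)

Lemma coef_linl a (x y z : H) : coef (a *: x + y) z = a *: coef x z + coef y z.
Proof.
by apply: funext => c; rewrite /Defs.coef (bopP (Bpi c)) (ipDl ip) (ipZl ip).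
Qed.

Lemma coef_linr a (x y z : H) : coef z (a *: x + y) = a^* *: coef z x + coef z y.
Proof. by apply: funext => c; rewrite /Defs.coef (ipDr ip) (ipZr ip). Qed.

Lemma coef_fourier (x y : H) : F (coef x y).
Proof. by exists (tens x y) => //; exact: fourier_map_tens. Qed.

Lemma coef_fourier_norm (x y : H) : normF (coef x y) <= nrm x * nrm y.
Proof.
rewrite -fourier_map_tens; apply: le_trans (fourier_norm_le _) _.
exact: (tens_norm hT).
Qed.

(** [mu] is bounded and the partial coefficient sums converge in the quotient norm, so the operator
    obtained from single coefficients determines [mu] on all sums. *)
Lemma dual_operator mu : dualF mu -> exists S,
  [/\ forall xi eta, ip (S xi) eta = mu (coef xi eta), B S &
      forall x y phi, abs_summable x y -> is_coef_sum x y phi ->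
        series (fun n => ip (S (x n)) (y n) : C^o) @ \oo --> mu phi].
Proof.
move=> dmu; have Fc := coef_fourier; have n0 := dual_norm_ge0 hF dmu.
have [|a x y z|a x y z|x y|S [hS BS _]] :=
    @bounded_form _ _ ip hH (fun xi eta => mu (coef xi eta)) (dual_norm F normF mu).
- exact: n0.
- by rewrite coef_linl (dual_lin _ dmu).
- by rewrite coef_linr (dual_lin _ dmu).
- apply: le_trans (dual_norm_ub hF dmu (Fc _ _)) _.
  by rewrite -mulrA ler_wpM2l// coef_fourier_norm.
exists S; split=> // x y phi xy xyphi.
have [Fphi _] := fourier_norm_le_total xy xyphi.
have [cv Fs] := fourier_series_cvg xy xyphi.
have sE n : series (fun n => ip (S (x n)) (y n) : C^o) n = mu (series (fun n => coef (x
  n) (y n)) n).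
  elim: n => [|n ih]; first by rewrite !seriesEnat /= !big_geq// (dual0 hF).
  by rewrite !seriesSr (dualD dmu)// ih hS.
apply/cvg_nrmP; apply: (cvg0_leM (M := dual_norm F normF mu)) cv => n;
  first exact: nrm_ge0.
rewrite sE -(dualB dmu)//; apply: (dual_norm_ub hF dmu).
exact: (banach_onB hF).
Qed.

Definition breve mu : H -> H :=
  xget (fun=> 0) [set S : H -> H | forall xi eta, ip (S xi) eta = mu (coef xi eta)].

Lemma breveP mu : dualF mu ->
  [/\ forall xi eta, ip (breve mu xi) eta = mu (coef xi eta), B (breve mu) &
      forall x y phi, abs_summable x y -> is_coef_sum x y phi ->
        series (fun n => ip (breve mu (x n)) (y n) : C^o) @ \oo --> mu phi].
Proof.
move=> /dual_operator[S [hS BS Sxy]].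
suff -> : breve mu = S by [].
apply: (op_eq hH) => x y; rewrite hS.
by have := @xgetI _ (fun=> 0) [set S : H -> H | forall xi eta, ip (S xi) eta = mu (coef
  xi eta)] S hS; exact.
Qed.

Lemma breve_coef mu xi eta : dualF mu -> ip (breve mu xi) eta = mu (coef xi eta).
Proof. by case/breveP. Qed.

Lemma breve_bounded mu : dualF mu -> B (breve mu).
Proof. by case/breveP. Qed.

Lemma breve_series mu x y phi : dualF mu -> abs_summable x y -> is_coef_sum x y phi ->
  series (fun n => ip (breve mu (x n)) (y n) : C^o) @ \oo --> mu phi.
Proof. by case/breveP => _ _; exact. Qed.

Lemma breve_VN mu : dualF mu -> VN (breve mu).
Proof.
move=> dmu; apply/VN_series; split; first exact: breve_bounded.
by move=> x y xy /(breve_series dmu xy); rewrite (dual0 hF dmu).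
Qed.

Lemma breve_inj mu nu : dualF mu -> dualF nu -> breve mu = breve nu -> mu = nu.
Proof.
move=> dmu dnu bmn; apply: funext => phi; have [Fphi|nF] := pselect (F phi).
  have [x [y [xy xyphi _]]] := fourier_rep Fphi ltr01.
  apply: (cvg_unique (@norm_hausdorff _ C^o) (breve_series dmu xy xyphi)).
  by rewrite bmn; exact: breve_series.
by have [-> // _ _] := dmu; have [-> // _ _] := dnu.
Qed.

(** The functional [mu_S], computed at an arbitrary preimage of [phi]. For [S] in the von Neumann
    algebra the choice is immaterial, since [tau S] vanishes on the kernel of [fourier_map]. The
    value 0 outside the Fourier space is what [dual] prescribes. *)
Definition vn_functional S : (A -> C^o) -> C^o := fun phi =>
  if phi \in F then tau ip tens S (xget 0 [set u | fmap u = phi]) else 0.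

Lemma vn_functionalE S u : VN S -> vn_functional S (fmap u) = tau ip tens S u.
Proof.
move=> /VN_tau[BS hS]; rewrite /vn_functional mem_set; last exact: fourier_map_in.
set v := xget _ _.
have vu : fmap v = fmap u by apply: (@xgetI _ 0 [set v | fmap v = fmap u] u).
have := hS (v - u); rewrite fourier_mapB vu subrr => /(_ erefl).
rewrite addrC -scaleN1r (tau_lin hH hT)// mulN1r addrC => /eqP.
by rewrite subr_eq0 => /eqP.
Qed.

Lemma vn_functional_series S x y phi : VN S -> abs_summable x y -> is_coef_sum x y phi
  ->
  series (fun n => ip (S (x n)) (y n) : C^o) @ \oo --> vn_functional S phi.
Proof.
move=> vS xy xyphi; have BS := VN_bounded vS.
have [u [<- xyu _]] := is_coef_sum_fourier xy xyphi.
by rewrite vn_functionalE//; exact: (tau_series hH hT).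
Qed.

Lemma vn_functional_coef S xi eta : VN S -> vn_functional S (coef xi eta) = ip (S xi)
  eta.
Proof.
move=> vS; rewrite -fourier_map_tens vn_functionalE//.
by have [_ _ ->] := tauP hH hT (VN_bounded vS).
Qed.

Lemma vn_functional_bound S phi : VN S -> F phi ->
  nrm (vn_functional S phi) <= op_norm S * normF phi.
Proof.
move=> vS Fphi; have BS := VN_bounded vS.
apply: ler_mul_eps; first exact: op_norm_ge0.
move=> e e0; have [u <- ue] := fourier_norm_adherent Fphi e0.
rewrite vn_functionalE//; apply: le_trans (tau_norm hH hT _ BS) _.
by rewrite ler_wpM2l ?op_norm_ge0// ltW.
Qed.

Lemma vn_functional_dual S : VN S -> dualF (vn_functional S).
Proof.
move=> vS; split.
- by move=> phi nF; rewrite /vn_functional memNset.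
- move=> c _ _ [u _ <-] [v _ <-]; rewrite -fourier_map_lin.
  by rewrite !vn_functionalE// (tau_lin hH hT)//; exact: VN_bounded vS.
- by exists (op_norm S) => phi; exact: vn_functional_bound.
Qed.

Lemma vn_functionalK S : VN S -> breve (vn_functional S) = S.
Proof.
move=> vS; apply: (op_eq hH) => x y.
by rewrite breve_coef ?vn_functional_coef//; exact: vn_functional_dual.
Qed.

Lemma breveK mu : dualF mu -> vn_functional (breve mu) = mu.
Proof.
move=> dmu; have vb := breve_VN dmu.
by apply: breve_inj => //; [exact: vn_functional_dual|exact: vn_functionalK].
Qed.

(** One inequality holds because a single coefficient of [x] and [y] has norm at most [|x| |y|]; the
    other because [mu] is recovered from its operator through [tau]. *)
Lemma breve_norm mu : dualF mu -> op_norm (breve mu) = dual_norm F normF mu.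
Proof.
move=> dmu; have Bb := breve_bounded dmu; have n0 := dual_norm_ge0 hF dmu.
apply/eqP; rewrite eq_le; apply/andP; split.
  apply: op_norm_le => // x; apply: (nrm_le_ip hH) => [|y].
    by rewrite mulr_ge0 ?nrm_ge0.
  rewrite -(ip_conj ip) nrm_conj breve_coef//.
  apply: le_trans (dual_norm_ub hF dmu (coef_fourier _ _)) _.
  by rewrite -mulrA ler_wpM2l// coef_fourier_norm.
apply: (dual_norm_le hF) => [|phi Fphi]; first exact: op_norm_ge0.
rewrite -{1}(breveK dmu); apply: vn_functional_bound => //; exact: breve_VN.
Qed.

Lemma breve_lin c mu nu : dualF mu -> dualF nu ->
  breve (c *: mu + nu) = c *: breve mu + breve nu.
Proof.
move=> dmu dnu; apply: (op_eq hH) => x y.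
rewrite breve_coef; last exact: (dual_comb hF).
by rewrite fun_linE (ipDl ip) (ipZl ip) !breve_coef.
Qed.

(** * Introversion, the Arens product and the involution on the dual *)

Lemma intro_act_coef nu xi eta : dualF nu ->
  intro_act mulA nu (coef xi eta) = coef (breve nu xi) eta.
Proof.
move=> dnu; apply: funext => a; rewrite /intro_act.
rewrite (_ : right_act mulA (coef xi eta) a = coef xi (pi (starA a) eta)).
  by rewrite -breve_coef// /Defs.coef -pi_star.
by apply: funext => b; rewrite /right_act /Defs.coef (rep_mul hpi) /= pi_star.
Qed.

Lemma intro_act_coef_sum nu x y phi : dualF nu -> abs_summable x y -> is_coef_sum x y
  phi ->
  is_coef_sum (breve nu \o x) y (intro_act mulA nu phi).
Proof.
move=> dnu xy xyphi a.
have [xay _] := abs_summable_compr (Bpi (starA a)) xy.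
have := breve_series dnu xay (@right_act_coef_sum _ _ _ a xyphi).
rewrite (_ : (fun n => _) = fun n => coef ((breve nu \o x) n) (y n) a)//.
by apply: funext => n; rewrite /Defs.coef /= -pi_star.
Qed.

Lemma fourier_intro_act nu phi : dualF nu -> F phi ->
  F (intro_act mulA nu phi) /\
  normF (intro_act mulA nu phi) <= dual_norm F normF nu * normF phi.
Proof.
move=> dnu Fphi; have Bb := breve_bounded dnu; have n0 := dual_norm_ge0 hF dnu.
have key e : 0 < e -> F (intro_act mulA nu phi) /\
    normF (intro_act mulA nu phi) <= dual_norm F normF nu * (normF phi + e).
  move=> e0; have [x [y [xy xyphi xye]]] := fourier_rep Fphi e0.
  have [xy' xye'] := abs_summable_compl Bb xy.
  have [? h] := fourier_norm_le_total xy' (intro_act_coef_sum dnu xy xyphi).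
  split=> //; apply: le_trans h _; apply: le_trans xye' _.
  by rewrite breve_norm// ler_wpM2l.
split; first by case: (key _ ltr01).
by apply: ler_mul_eps => // e /key[].
Qed.

Lemma fourier_introverted : left_introverted_homogeneous mulA F normF.
Proof.
split.
- by move=> phi /fourier_Adual[].
- exact: hF.
- by move=> phi /fourier_Adual[].
- by move=> phi a; exact: fourier_right_act.
- exact: fourier_intro_act.
Qed.

Lemma dual_mul_dual mu nu : dualF mu -> dualF nu -> dualF (dual_mul mulA F mu nu).
Proof.
move=> dmu dnu; have Fi phi : F phi -> F (intro_act mulA nu phi).
  by move=> Fphi; case: (fourier_intro_act dnu Fphi).
split.
- by move=> phi nF; rewrite /dual_mul memNset.
- move=> c phi psi Fphi Fpsi; rewrite /dual_mul !mem_set//; last exact: (banach_onP hF).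
  rewrite -(dual_lin c dmu (Fi _ Fphi) (Fi _ Fpsi)); congr (mu _); apply: funext => a.
  rewrite [RHS](_ : _ = c * nu (right_act mulA phi a) + nu (right_act mulA psi a))//.
  have [Fpa _] := fourier_right_act a Fphi; have [Fqa _] := fourier_right_act a Fpsi.
  by rewrite -(dual_lin c dnu Fpa Fqa).
- exists (dual_norm F normF mu * dual_norm F normF nu) => phi Fphi.
  rewrite /dual_mul mem_set//; have [Fn nn] := fourier_intro_act dnu Fphi.
  apply: le_trans (dual_norm_ub hF dmu Fn) _.
  by rewrite -mulrA ler_wpM2l// (dual_norm_ge0 hF).
Qed.

Lemma breve_mul mu nu : dualF mu -> dualF nu ->
  breve (dual_mul mulA F mu nu) = breve mu \o breve nu.
Proof.
move=> dmu dnu; apply: (op_eq hH) => x y.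
rewrite breve_coef; last exact: dual_mul_dual.
by rewrite /dual_mul mem_set ?intro_act_coef ?breve_coef//; exact: coef_fourier.
Qed.

Lemma dual_star_dual mu : dualF mu -> dualF (dual_star starA mu).
Proof.
move=> dmu; have [omu _ _] := dmu; split.
- move=> phi nF; rewrite /dual_star omu ?conjC0// => /fourier_func_star[].
  by rewrite func_starK.
- move=> c phi psi Fphi Fpsi; rewrite /dual_star func_star_lin.
  have [Fp _] := fourier_func_star Fphi; have [Fq _] := fourier_func_star Fpsi.
  by rewrite (dual_lin _ dmu)// rmorphD rmorphM /= conjCK.
- exists (dual_norm F normF mu) => phi Fphi.
  rewrite /dual_star [nrm _](_ : _ = nrm (mu (func_star starA phi)));
    last exact: nrm_conj.
  have [Fp <-] := fourier_func_star Fphi; exact: (dual_norm_ub hF dmu Fp).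
Qed.

Lemma breve_star mu : dualF mu -> breve (dual_star starA mu) = adjoint ip (breve mu).
Proof.
move=> dmu; apply: (op_eq hH) => x y.
rewrite breve_coef; last exact: dual_star_dual.
rewrite /dual_star func_star_coef -breve_coef// ip_conj.
by rewrite -(ip_conj ip) (adjointP hH (breve_bounded dmu)) ip_conj.
Qed.

Lemma canonical_hom_dual a : dualF (canonical_hom F a).
Proof.
split.
- by move=> phi nF; rewrite /canonical_hom memNset.
- move=> c phi psi Fphi Fpsi; rewrite /canonical_hom !mem_set//.
  exact: (banach_onP hF).
- exists (nrm a) => phi Fphi; rewrite /canonical_hom mem_set//.
  exact: fourier_bound.
Qed.

Lemma breve_canonical_hom a : breve (canonical_hom F a) = pi a.
Proof.
apply: (op_eq hH) => x y; rewrite breve_coef; last exact: canonical_hom_dual.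
by rewrite /canonical_hom mem_set//; exact: coef_fourier.
Qed.

(** * The W*-algebra structure and the isomorphisms *)

Local Notation Fdual := (fourier_dual mulA starA ip pi tens).
Local Notation VNpi := (VN_data ip pi).

(** [breve] is injective and isometric and respects all operations, so each algebraic axiom and norm
    condition is the corresponding fact about bounded operators; completeness is that of a dual
    space. *)
Lemma fourier_dual_cstar : cstar_algebra Fdual.
Proof.
have bI := breve_inj.
have bm := breve_mul; have bs := breve_star.
have bl := breve_lin; have bn := breve_norm.
have bB := breve_bounded.
have dm := dual_mul_dual; have ds := dual_star_dual.
have dl := dual_comb hF.
split; [exact: (dual_banach hF)|split|] => /=.
- exact: dm.
- by move=> x y z dx dy dz; apply: bI; rewrite ?bm;
    do ?[by auto|apply: dm|apply: dl|apply: ds].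
- by move=> a x y z dx dy dz; apply: bI; rewrite ?(bm, bl);
    do ?[by auto|apply: dm|apply: dl|apply: ds].
- move=> a x y z dx dy dz; apply: bI; rewrite ?(bm, bl);
    do ?[by auto|apply: dm|apply: dl|apply: ds].
  by apply: funext => t; rewrite /= fun_linE (bopP (bB _ dz)).
- by move=> x y dx dy; rewrite -!bn ?bm; do ?[by auto|apply: dm|apply: dl|apply: ds];
    apply: op_norm_comp; exact: bB.
- exact: ds.
- by move=> a x y dx dy; apply: bI; rewrite ?(bs, bl) ?(adjoint_lin hH);
    do ?[by auto|apply: dm|apply: dl|apply: ds].
- by move=> x y dx dy; apply: bI; rewrite ?(bs, bm);
    do ?[by auto|apply: (adjoint_comp hH)|apply: dm|apply: dl|apply: ds].
- by move=> x dx; apply: bI; rewrite ?bs ?(adjointK hH);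
    do ?[by auto|apply: dm|apply: dl|apply: ds].
- by move=> x dx; rewrite -!bn ?bs ?(op_norm_adjoint hH);
    do ?[by auto|apply: dm|apply: dl|apply: ds].
- by move=> x dx; rewrite -!bn ?bm ?bs ?(op_norm_cstar hH);
    do ?[by auto|apply: dm|apply: dl|apply: ds].
Qed.

(** The predual is the Fourier space itself, and the identification is the identity map. *)
Lemma fourier_dual_wstar : wstar_algebra Fdual.
Proof.
split; first exact: fourier_dual_cstar.
exists (A -> C^o), F, normF; split; first exact: hF.
by exists id; split=> //; exact: (set_bij_can (g := id)).
Qed.

Lemma breve_bij : set_bij dualF VN breve.
Proof.
apply: (set_bij_can (g := vn_functional)).
- exact: breve_VN.
- exact: vn_functional_dual.
- exact: breveK.
- exact: vn_functionalK.
Qed.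

Lemma vn_functional_bij : set_bij VN dualF vn_functional.
Proof.
apply: (set_bij_can (g := breve)).
- exact: vn_functional_dual.
- exact: breve_VN.
- exact: vn_functionalK.
- exact: breveK.
Qed.

Lemma breve_iso : @isometric_star_isomorphism _ Fdual VNpi breve.
Proof.
split; first exact: breve_bij.
- exact: breve_lin.
- exact: breve_mul.
- exact: breve_star.
- exact: breve_norm.
Qed.

(** Each operator is rewritten as the [breve] of its functional, so that the laws of [breve] can be
    read backwards. *)
Lemma vn_functional_iso : @isometric_star_isomorphism _ VNpi Fdual vn_functional.
Proof.
have vK := vn_functionalK; have bK := breveK.
have vd := vn_functional_dual.
split; first exact: vn_functional_bij.
- move=> a S S' vS vS'; rewrite -[X in vn_functional (_ *: X + _)]vK// -[X in
    vn_functional (_ + X)]vK//.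
  rewrite -breve_lin ?bK//; try exact: vd.
  by apply: (dual_comb hF); exact: vd.
- move=> S S' vS vS' /=; rewrite -[X in vn_functional (X \o _)]vK// -[X in
    vn_functional (_ \o X)]vK//.
  rewrite -breve_mul ?bK//; try exact: vd.
  by apply: dual_mul_dual; exact: vd.
- move=> S vS /=; rewrite -[X in vn_functional (adjoint _ X)]vK//.
  rewrite -breve_star ?bK//; try exact: vd.
  by apply: dual_star_dual; exact: vd.
- move=> S vS /=; rewrite -breve_norm ?vK//; exact: vd.
Qed.

(** * Comparison of the two weak* topologies *)

Let coef_sum_exists (z : set_type summables) :
  exists phi, is_coef_sum (set_val z).1 (set_val z).2 phi.
Proof.
have [u zu _] := abs_summableP hT (set_valP z).
by exists (fmap u); exact: fourier_map_sum.
Qed.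

(** Both topologies have the same coordinates: pairing [breve nu] with a summable pair is evaluating
    [nu] at the coefficient sum of that pair. The inverse map uses that every element of the Fourier
    space is such a sum. *)
Lemma breve_continuous :
  forall mu, dualF mu ->
  breve @ within dualF (nbhs (mu : weakstar (A -> C^o))) --> (breve mu :
    operator_weakstar ip).
Proof.
move=> mu dmu; apply/(operator_weakstar_cvgP ip (breve mu) _) => z.
have [phi zphi] := coef_sum_exists z.
have bE nu : dualF nu -> trace_pairing ip (breve nu) z = nu phi.
  move=> dnu; apply: (cvg_lim (@norm_hausdorff _ C^o)).
  exact: (breve_series dnu (set_valP z) zphi).
rewrite bE//; have /ptws_cvgP h : within dualF (nbhs (mu : weakstar (A -> C^o))) -->
  (mu : {ptws (A -> C^o) -> C^o}).
  exact: cvg_within.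
by apply: cvg_within_eq (h phi) => nu dnu; rewrite bE.
Qed.

Lemma vn_functional_continuous :
  forall S, VN S ->
  vn_functional @ within VN (nbhs (S : operator_weakstar ip)) --> (vn_functional S :
    weakstar (A -> C^o)).
Proof.
move=> S vS; apply/ptws_cvgP => phi.
suff h : vn_functional P phi @[P --> within VN (nbhs (S : operator_weakstar ip))] -->
  vn_functional S phi.
  exact: h.
have FS := nbhs_filter (S : operator_weakstar ip).
(* Evaluation at a [phi] outside the Fourier space is also a coordinate of the pointwise topology,
   but the cut-off makes it constant. *)
have [Fphi|nF] := pselect (F phi); last first.
  have v0 P : vn_functional P phi = 0 by rewrite /vn_functional memNset.
  rewrite v0; apply: (@cvg_within_eq _ _ _ VN _ (fun=> 0)) => [P _|]; first exact: v0.
  exact: cvg_cst.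
have [x [y [xy xyphi _]]] := fourier_rep Fphi ltr01.
pose z : set_type summables := SigSub (mem_set (xy : summables (x, y))).
have vE P : VN P -> vn_functional P phi = trace_pairing ip P z.
  move=> vP; apply/esym/(cvg_lim (@norm_hausdorff _ C^o)).
  exact: (vn_functional_series vP xy xyphi).
have h : trace_pairing ip P z @[P --> within VN (nbhs (S : operator_weakstar ip))] -->
    trace_pairing ip S z.
  move=> U Ul; have hU : nbhs (S : operator_weakstar ip) ((fun P => trace_pairing ip P
    z) @^-1` U).
    exact: trace_pairing_continuous Ul.
  by apply: (@filterS _ _ FS _ _ _ hU) => P UP _; exact: UP.
by rewrite vE//; apply: cvg_within_eq h => P vP; rewrite vE.
Qed.

Lemma breve_homeomorphic : homeomorphic_on (X := weakstar (A -> C^o))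
  (Y := operator_weakstar ip) dualF VN breve.
Proof.
split; [exact: breve_bij|exact/subspace_continuousP/breve_continuous|].
exists vn_functional; first exact/subspace_continuousP/vn_functional_continuous.
exact: breveK.
Qed.

Lemma vn_functional_homeomorphic : homeomorphic_on (X := operator_weakstar ip)
  (Y := weakstar (A -> C^o)) VN dualF vn_functional.
Proof.
split; [exact: vn_functional_bij|exact/subspace_continuousP/vn_functional_continuous|].
exists breve; first exact/subspace_continuousP/breve_continuous.
exact: vn_functionalK.
Qed.

End FourierSpace.

Theorem theorem5p1 (R : realType)
    (A : completeNormedModType R[i]) (mulA : A -> A -> A) (starA : A -> A)
    (hA : involutive_banach_algebra mulA starA)
    (H : completeNormedModType R[i]) (ip : {dot H for Num.conj})
    (hH : hilbert_product ip)
    (pi : A -> H -> H) (hpi : star_representation mulA starA ip pi)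
    (T : completeNormedModType R[i]) (tens : {bilinear H -> conjugate H -> T})
    (hT : projective_tensor_product tens) :
  let F := fourier_space ip pi tens in
  let normF := fourier_norm ip pi tens in
  let Fdual := fourier_dual mulA starA ip pi tens in
  let VNpi := VN_data ip pi in
  [/\ forall xi eta : nat -> H, abs_summable xi eta ->
        (exists phi, is_coef_sum ip pi xi eta phi) /\
        forall phi, is_coef_sum ip pi xi eta phi ->
          F phi /\
          normF (series (fun n => coef ip pi (xi n) (eta n)) n - phi)
            @[n --> \oo] --> (0 : R),
      forall phi, F phi -> exists xi eta : nat -> H,
        abs_summable xi eta /\ is_coef_sum ip pi xi eta phi &
      forall phi, F phi -> normF phi =
        inf [set s : R | exists xi eta : nat -> H,
          [/\ abs_summable xi eta, is_coef_sum ip pi xi eta phi &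
              s = limn (series (fun n => nrm (xi n) * nrm (eta n)))]]]
  /\
  [/\ left_introverted_homogeneous mulA F normF,
      forall phi, F phi -> F (func_star starA phi),
      forall xi eta : H,
        func_star starA (coef ip pi xi eta) = coef ip pi eta xi,
      forall phi, Adual phi ->
        Adual (func_star starA phi) /\
        Adual_norm (func_star starA phi) = Adual_norm phi &
      forall phi, F phi -> normF (func_star starA phi) = normF phi]
  /\
  [/\ wstar_algebra Fdual,
      exists brevepi : Fdual -> VNpi,
        [/\ forall mu, dom Fdual mu -> forall xi eta : H,
              ip (brevepi mu xi) eta = mu (coef ip pi xi eta),
            isometric_star_isomorphism brevepi,
            homeomorphic_on (X := weakstar (A -> R[i]^o))
              (Y := operator_weakstar ip) (dom Fdual) (VN ip pi) brevepi &
            forall a : A, dom Fdual (canonical_hom F a) /\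
              brevepi (canonical_hom F a) = pi a] &
      [/\ von_neumann_subalgebra ip (VN ip pi),
          range pi `<=` VN ip pi &
          forall M, von_neumann_subalgebra ip M -> range pi `<=` M ->
            VN ip pi `<=` M]]
  /\
  exists m : VNpi -> Fdual,
    [/\ forall S, VN ip pi S ->
          forall (xi eta : nat -> H) phi,
            abs_summable xi eta -> is_coef_sum ip pi xi eta phi ->
            series (fun n => ip (S (xi n)) (eta n) : R[i]^o) @ \oo -->
              m S phi,
        isometric_star_isomorphism m &
        homeomorphic_on (X := operator_weakstar ip)
          (Y := weakstar (A -> R[i]^o)) (VN ip pi) (dom Fdual) m].
Proof.
move=> F normF Fdual VNpi.
have part_le xi eta phi : abs_summable xi eta -> is_coef_sum ip pi xi eta phi ->
    F phi /\ normF phi <= limn (series (fun n => nrm (xi n) * nrm (eta n))).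
  exact: (fourier_norm_le_total hH hpi hT).
split; first split.
- move=> xi eta xe; split.
    have [u xeu _] := abs_summableP hT xe.
    by exists (fourier_map ip pi tens u); exact: (fourier_map_sum hH hpi hT).
  move=> phi xephi; split; first by case: (part_le _ _ _ xe xephi).
  by case: (fourier_series_cvg hH hpi hT xe xephi).
- move=> phi Fphi; have [xi [eta [xe xephi _]]] := fourier_rep hH hpi hT Fphi ltr01.
  by exists xi, eta.
- move=> phi Fphi; apply/eqP; rewrite eq_le; apply/andP; split.
    apply: lb_le_inf.
      have [xi [eta [xe xephi _]]] := fourier_rep hH hpi hT Fphi ltr01.
      by eexists; exists xi, eta.
    by move=> _ [xi [eta [xe xephi ->]]]; case: (part_le _ _ _ xe xephi).
  (* The norm is a lower bound of all totals; representations whose total is within [e] of it give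
     the other inequality. *)
  apply/ler_addgt0Pr => e e0.
  have [xi [eta [xe xephi h]]] := fourier_rep hH hpi hT Fphi e0.
  apply: le_trans h; apply: ge_inf; last by exists xi, eta.
  exists (normF phi) => _ [xi' [eta' [xe' xephi' ->]]].
  by case: (part_le _ _ _ xe' xephi').
split; first split.
- exact: (fourier_introverted hA hH hpi hT).
- by move=> phi /(fourier_func_star hA hH hpi hT)[].
- exact: (func_star_coef hpi).
- exact: (Adual_func_star hA).
- by move=> phi /(fourier_func_star hA hH hpi hT)[].
split; first split.
- exact: (fourier_dual_wstar hA hH hpi hT).
- exists (breve ip pi); split.
  + by move=> mu dmu xi eta; exact: (breve_coef hA hH hpi hT).
  + exact: (breve_iso hA hH hpi hT).
  + exact: (breve_homeomorphic hA hH hpi hT).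
  + by move=> a; split; [exact: (canonical_hom_dual hA hH hpi hT)|exact:
      (breve_canonical_hom hA hH hpi hT)].
- split; first exact: (VN_von_neumann hH hpi hT).
  + by move=> _ [a _ <-]; exact: (VN_pi hH hpi hT).
  + exact: VN_min.
exists (vn_functional ip pi tens); split.
- by move=> S vS xi eta phi; exact: (vn_functional_series hH hpi hT).
- exact: (vn_functional_iso hA hH hpi hT).
- exact: (vn_functional_homeomorphic hA hH hpi hT).
Qed.
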